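(* Let $G$ be a Carnot group of step $s$. For any $\lambda > 0$, there exists a constant $C > 0$ depending only on $d_{HS}$, $\lambda$, and the Euclidean structure $|\cdot|$ so that the following holds. Let $p_1,p_2,p_3,p_4 \in G$ be points so that $\lambda \ell \leq d_{HS}(p_i,p_j) \leq \ell$ if $i \neq j$, for some $\ell > 0$. Then $$\sum_{i=1}^s \left(\sup_{t \in [0,1]} \frac{d_{HS}(\pi_i(L_{p_1,p_3}(t)),\pi_i(\overline{p_1,p_4}))^{2i}}{\ell^{2i-1}} + \sup_{t \in [0,1]} \frac{d_{HS}(\pi_i(L_{p_3,p_4}(t)),\pi_i(\overline{p_1,p_4}))^{2i}}{\ell^{2i-1}}\right) \leq C \Delta,$$ where $\Delta = \sum_{i=2}^s \Delta_i(p_1,p_2,p_3,p_4)$.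
   Context: A Carnot group of step $s$ is a simply connected Lie group $G$ whose Lie algebra has a stratification $\mathfrak g = V_1\oplus\cdots\oplus V_s$ with $[V_1,V_j]=V_{j+1}$ for $j\ge 1$ (with $V_k=0$ for $k>s$ and $V_s\ne 0$). Via $\exp$ and a choice of bases of the $V_i$, $G$ is identified with $\mathbb R^n=\mathbb R^{n_1+\cdots+n_s}$, $n_i=\dim V_i$ (exponential coordinates $g=(g_1,\dots,g_s)$, identity $0$). The automorphisms $\delta_\lambda(g_1,\dots,g_s)=(\lambda g_1,\lambda^2 g_2,\dots,\lambda^s g_s)$ are the dilations ($\delta_0(g)=0$). For $1\le i\le s$, $\pi_i:G\to G/\exp(V_{i+1}\oplus\cdots\oplus V_s)$ is the quotient homomorphism, $\pi_i(g)=(g_1,\dots,g_i)$; $\pi_i(G)\cong\mathbb R^{n_1+\cdots+n_i}$ is again a Carnot group. Hebisch–Sikora norm: let $\|\cdot\|$ be the standard Euclidean norm in coordinates and fix a sufficiently small $\eta_*>0$; set $N_{HS}(g)=\inf\{\lambda>0:\|\delta_{1/\lambda}(g)\|<\eta_*\}$, on $G$ and (same formula, same $\eta_*$) on each $\pi_i(G)$. For $\eta_*$ small (by Hebisch–Sikora) these are all subadditive homogeneous norms, smooth away from $0$. Put $d_{HS}(g,h)=N_{HS}(g^{-1}h)$ on $G$ and on each $\pi_i(G)$, and $|\cdot|=\|\cdot\|/\eta_*$. Distance to a set is the infimum of distances. Let $\tilde\pi(g_1,\dots,g_s)=(g_1,0,\dots,0)$. For $g,h\in G$, $t\in[0,1]$,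 $L_{g,h}(t)=g\,\delta_t(\tilde\pi(g^{-1}h))$ and $\overline{g,h}=\{L_{g,h}(t):t\in[0,1]\}$. The triangle inequality excess is $$\Delta_i(p_1,\dots,p_k)=\sum_{j=1}^{k-1}d_{HS}(\pi_i(p_j),\pi_i(p_{j+1}))-d_{HS}(\pi_i(p_1),\pi_i(p_k)).$$
   Formalization: The step is assumed to satisfy s ≥ 2: for s = 1 the sum Δ is empty, hence 0, and the inequality fails, e.g. for non-collinear p_1, p_3, p_4 in R^2. *)

(* Defs.v *)
From HB Require Import structures.
From mathcomp Require Import all_boot all_order all_algebra.
From mathcomp Require Import all_classical all_reals all_analysis.

Set Implicit Arguments.
Unset Strict Implicit.
Unset Printing Implicit Defensive.

Import Order.TTheory GRing.Theory Num.Theory.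
Import numFieldNormedType.Exports.

Local Open Scope classical_set_scope.
Local Open Scope ring_scope.

(* C^k and C^oo maps between normed spaces (used in finite dimension only). *)
Fixpoint Ck (R : realType) (U V : normedModType R) (k : nat) (f : U -> V)
    : Prop :=
  match k with
  | 0 => continuous f
  | k'.+1 => (forall x, differentiable f x) /\
             (forall v, Ck k' (fun x => 'D_v f x))
  end.

Definition smooth (R : realType) (U V : normedModType R) (f : U -> V) : Prop :=
  forall k, Ck k f.

Definition linear_span (R : realType) (V : lmodType R) (A : set V) : set V :=
  [set x | exists (m : nat) (c : 'I_m -> R) (a : 'I_m -> V),
     (forall k, A (a k)) /\ x = \sum_(k < m) c k *: a k].

(* The left-invariant vector field of the group law [mul] (with identity 0)
   whose value at the identity is [X]. *)
Definition left_field (R : realType) (n : nat)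
    (mul : 'rV[R]_n -> 'rV[R]_n -> 'rV[R]_n) (X g : 'rV[R]_n) : 'rV[R]_n :=
  'D_X (mul g) 0.

(* The Lie algebra is the tangent space R^n at 0; its bracket is the commutator
   of left-invariant vector fields, evaluated at the identity. *)
Definition lie_bracket (R : realType) (n : nat)
    (mul : 'rV[R]_n -> 'rV[R]_n -> 'rV[R]_n) (X Y : 'rV[R]_n) : 'rV[R]_n :=
  'D_X (left_field mul Y) 0 - 'D_Y (left_field mul X) 0.

(* A basis adapted to V_1 + ... + V_s is recorded by [deg : 'I_n -> nat]: the
   j-th basis vector lies in V_(deg j), so that n_i = #|[set j | deg j == i]|.
   The component g_i of g consists of the coordinates of degree i. *)
Definition layer (R : realType) (n : nat) (deg : 'I_n -> nat) (i : nat)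
    : set 'rV[R]_n :=
  [set x | forall j, deg j != i -> x 0 j = 0].

Definition dil (R : realType) (n : nat) (deg : 'I_n -> nat) (lam : R)
    (x : 'rV[R]_n) : 'rV[R]_n :=
  \row_j (lam ^+ deg j * x 0 j).

(* [trunc deg i x] is (x_1, ..., x_i, 0, ..., 0). *)
Definition trunc (R : realType) (n : nat) (deg : 'I_n -> nat) (i : nat)
    (x : 'rV[R]_n) : 'rV[R]_n :=
  \row_j (if (deg j <= i)%N then x 0 j else 0).

(* A Carnot group of step s in exponential coordinates: a Lie group law on R^n
   with identity 0 for which exp is the identity map, i.e. t |-> t X is the
   one-parameter subgroup of velocity X ([cg_exp]).  [cg_strat] says
   [V_1, V_i] = V_(i+1) for all i >= 1; for i = s this is [V_1, V_s] = 0, since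
   all degrees are at most s. [cg_dil] follows from the stratification, and is
   recorded because the dilations are part of the structure. *)
Record carnotGroup (R : realType) (s n : nat) := CarnotGroup {
  cg_deg : 'I_n -> nat;
  cg_mul : 'rV[R]_n -> 'rV[R]_n -> 'rV[R]_n;
  cg_inv : 'rV[R]_n -> 'rV[R]_n;
  cg_mulA : forall x y z, cg_mul x (cg_mul y z) = cg_mul (cg_mul x y) z;
  cg_mul0l : forall x, cg_mul 0 x = x;
  cg_mulVl : forall x, cg_mul (cg_inv x) x = 0;
  cg_smooth_mul :
    smooth (fun xy : 'rV[R]_n * 'rV[R]_n => cg_mul xy.1 xy.2);
  cg_smooth_inv : smooth cg_inv;
  cg_exp : forall (a b : R) (X : 'rV[R]_n),
    cg_mul (a *: X) (b *: X) = (a + b) *: X;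
  cg_deg_range : forall j, (1 <= cg_deg j <= s)%N;
  cg_deg_top : exists j, cg_deg j = s;
  cg_strat : forall i, (1 <= i)%N ->
    linear_span [set lie_bracket cg_mul X Y |
                   X in layer cg_deg 1 & Y in layer cg_deg i]
    = layer cg_deg i.+1;
  cg_dil : forall (lam : R) (x y : 'rV[R]_n), 0 < lam ->
    dil cg_deg lam (cg_mul x y)
    = cg_mul (dil cg_deg lam x) (dil cg_deg lam y)
}.

Definition enorm (R : realType) (n : nat) (x : 'rV[R]_n) : R :=
  Num.sqrt (\sum_j x 0 j ^+ 2).

Definition NHS (R : realType) (n : nat) (deg : 'I_n -> nat) (eta : R)
    (x : 'rV[R]_n) : R :=
  inf [set lam | 0 < lam /\ enorm (dil deg lam^-1 x) < eta].

Definition dHS (R : realType) (s n : nat) (G : carnotGroup R s n) (eta : R)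
    (g h : 'rV[R]_n) : R :=
  NHS (cg_deg G) eta (cg_mul G (cg_inv G g) h).

(* The quotient pi_i(G) = R^(n_1 + ... + n_i) is represented by the vectors of
   R^n whose coordinates of degree > i vanish; this padding by zeros preserves
   the Euclidean norm and the dilations.  The quotient group law is obtained by
   operating on these representatives in G and projecting again. *)
Definition cpi (R : realType) (s n : nat) (G : carnotGroup R s n) (i : nat)
    (g : 'rV[R]_n) : 'rV[R]_n :=
  trunc (cg_deg G) i g.

Definition qmul (R : realType) (s n : nat) (G : carnotGroup R s n) (i : nat)
    (x y : 'rV[R]_n) : 'rV[R]_n :=
  cpi G i (cg_mul G x y).

Definition qinv (R : realType) (s n : nat) (G : carnotGroup R s n) (i : nat)
    (x : 'rV[R]_n) : 'rV[R]_n :=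
  cpi G i (cg_inv G x).

(* d_HS on pi_i(G); the arguments are meant to be in the range of [cpi G i]. *)
Definition qdHS (R : realType) (s n : nat) (G : carnotGroup R s n) (eta : R)
    (i : nat) (x y : 'rV[R]_n) : R :=
  NHS (cg_deg G) eta (qmul G i (qinv G i x) y).

Definition qdist (R : realType) (s n : nat) (G : carnotGroup R s n) (eta : R)
    (i : nat) (x : 'rV[R]_n) (A : set 'rV[R]_n) : R :=
  inf [set qdHS G eta i x y | y in A].

(* L_{g,h}(t); [trunc _ 1] is the horizontal projection
   (g_1, ..., g_s) |-> (g_1, 0, ..., 0). *)
Definition hline (R : realType) (s n : nat) (G : carnotGroup R s n)
    (g h : 'rV[R]_n) (t : R) : 'rV[R]_n :=
  cg_mul G g (dil (cg_deg G) t (trunc (cg_deg G) 1 (cg_mul G (cg_inv G g) h))).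

Definition hsegment (R : realType) (s n : nat) (G : carnotGroup R s n)
    (g h : 'rV[R]_n) : set 'rV[R]_n :=
  [set hline G g h t | t in `[0, 1]].

(* The triangle inequality excess Delta_i(p_1, ..., p_k). *)
Definition excess (R : realType) (s n : nat) (G : carnotGroup R s n) (eta : R)
    (i : nat) (p : seq 'rV[R]_n) : R :=
  \sum_(j < (size p).-1)
     qdHS G eta i (cpi G i (nth 0 p j)) (cpi G i (nth 0 p j.+1))
  - qdHS G eta i (cpi G i (head 0 p)) (cpi G i (last 0 p)).

(* sup_t d_HS(pi_i(L_{g,h}(t)), pi_i(A))^{2i} / l^{2i-1} *)
Definition sup_dev (R : realType) (s n : nat) (G : carnotGroup R s n) (eta : R)
    (i : nat) (l : R) (g h : 'rV[R]_n) (A : set 'rV[R]_n) : R :=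
  sup [set qdist G eta i (cpi G i (hline G g h t)) (cpi G i @` A) ^+ (2 * i)
             / l ^+ (2 * i - 1) | t in `[0, 1]].

(* Main.v *)
Require Import Defs.
From HB Require Import structures.
From mathcomp Require Import all_boot all_order all_algebra.
From mathcomp Require Import all_classical all_reals all_analysis.
From mathcomp Require Import ring lra.

Import Order.TTheory GRing.Theory Num.Theory.
Import numFieldNormedType.Exports.

Local Open Scope classical_set_scope.
Local Open Scope ring_scope.

(** Put [x] and [y] on the sphere of radius [eta] and let [Q(x, y)] be
    |x_1 - y_1|^2 + sum_(k >= 2) (|x_k|^2 + |y_k|^2).  The group law is additive
    on one-parameter subgroups and its second-order part is bilinear up to a
    constant, so for small [eta]
      |delta_t(x) delta_(1-t)(y)|^2 <= eta^2 - t (1 - t) Q(x, y) / 2.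
    Rescaled, this bounds N(a) + N(b) - N(ab) below by a multiple of
    N(a) N(b) / (N(a) + N(b)) * Q.  Applied to a = p_1^-1 p_3, b = p_3^-1 p_4
    it shows that Delta_s alone controls [l Q].  On the other hand
    Q(x, y)^(1/2) bounds the Euclidean distance from the rescaled horizontal
    segments of the two legs to that of the chord, and in pi_i(G) the norm [N] is
    at most an [i]-th root of the Euclidean length, so d^(2 i) is of order [Q]. *)

(** * Mixed second differences *)

Section MixedDifference.
#[local] Set Implicit Arguments.
Context {R : realType} {U : normedModType R} {n : nat}.
Implicit Types (f : U -> 'rV[R]_n) (p v w : U).

Lemma is_derive_line f p w (j : 'I_n) (t : R) :
  differentiable f (p + t *: w) ->
  is_derive t 1 (fun s : R => f (p + s *: w) 0 j) ('D_w f (p + t *: w) 0 j).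
Proof.
move=> /diff_derivable df0; have df : derivable f (p + t *: w) w by exact: df0.
have dj := (derivable_mxP f (p + t *: w) w).1 df 0 j.
rewrite (derive_mx df) mxE.
have E : (fun h : R => h^-1 *: (f (p + (h *: 1 + t) *: w) 0 j - f (p + t *: w) 0 j))
   = (fun h : R => h^-1 *: (f (h *: w + (p + t *: w)) 0 j - f (p + t *: w) 0 j)).
  apply/funext => h; congr (_ *: (f _ 0 j - _)).
  by rewrite [h *: 1]mulr1 scalerDl addrCA.
by split; rewrite /derivable /derive /= E.
Qed.

Lemma mean_value_line f p w (j : 'I_n) : (forall x, differentiable f x) ->
  exists2 c, 0 <= c <= 1 & f (p + w) 0 j - f p 0 j = 'D_w f (p + c *: w) 0 j.
Proof.
move=> df.
have D (t : R) := @is_derive_line f p w j t (df _).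
have [|c] := @MVT R _ _ 0 1 ltr01 (fun t _ => D t).
  by apply: derivable_within_continuous => t _; have [] := D t.
rewrite in_itv /= scale1r scale0r addr0 subr0 mulr1 => /andP[c0 c1] ->.
by exists c; rewrite // !ltW.
Qed.

(** Two applications of the mean value theorem: first to the difference of [f] along the parallel
    lines through [p + v] and [p], then to ['D_w f] in the direction [v]. The intermediate points
    depend on the coordinate [j]. *)
Lemma mean_value_mixed f p w v (j : 'I_n) :
  (forall x, differentiable f x) -> (forall x, differentiable ('D_w f) x) ->
  exists2 cd : R * R, (0 <= cd.1 <= 1) && (0 <= cd.2 <= 1) &
    f (p + w + v) 0 j - f (p + w) 0 j - f (p + v) 0 j + f p 0 j
    = 'D_v ('D_w f) (p + cd.1 *: w + cd.2 *: v) 0 j.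
Proof.
move=> df ddf.
have D (t : R) := @is_deriveB _ _ _ _ _ _ _ _ _
  (@is_derive_line f (p + v) w j t (df _)) (@is_derive_line f p w j t (df _)).
have [|c] := @MVT R _ _ 0 1 ltr01 (fun t _ => D t).
  by apply: derivable_within_continuous => t _; have [] := D t.
rewrite in_itv /= => /andP[c0 c1].
rewrite !fctE !scale1r !scale0r !addr0 subr0 mulr1 => E.
have [d d01 E'] := @mean_value_line ('D_w f) (p + c *: w) v j ddf.
exists (c, d) => /=; first by rewrite (ltW c0) (ltW c1).
rewrite -E' [p + c *: w + v]addrAC -E [p + w + v]addrAC; ring.
Qed.

Lemma derive_sum_dir f v (m : nat) (c : 'I_m -> R) (b : 'I_m -> U) :
  (forall x, differentiable f x) -> v = \sum_k c k *: b k ->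
  forall x, 'D_v f x = \sum_k c k *: 'D_(b k) f x.
Proof.
move=> df -> x; rewrite deriveE// linear_sum.
by apply: eq_bigr => k _; rewrite linearZ deriveE.
Qed.

End MixedDifference.

(** * A bilinear bound on the mixed second difference of a C^2 product *)

Section LocalLipschitz.
#[local] Set Implicit Arguments.
Context {R : realType} {n : nat}.
Variable M : 'rV[R]_n -> 'rV[R]_n -> 'rV[R]_n.
Let F (xy : 'rV[R]_n * 'rV[R]_n) : 'rV[R]_n := M xy.1 xy.2.
Hypothesis F2 : Ck 2 F.

Lemma coord_le_norm (x : 'rV[R]_n) j : `|x 0 j| <= `|x|.
Proof.
rewrite [leRHS]mx_normrE.
exact: (@le_bigmax _ _ _ 0 (fun ij : 'I_1 * 'I_n => `|x ij.1 ij.2|) (0, j)).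
Qed.

(** The left side is a second derivative of [F] taken once in each factor. It is bilinear in the two
    increments, with the mixed partials [G] as coefficients, and these finitely many continuous
    functions are bounded on a common ball around 0. *)
Lemma mixed_difference_bound : exists r K : R, [/\ 0 < r, 0 < K &
  forall u u' v v' : 'rV[R]_n, `|u| < r -> `|u'| < r -> `|v| < r -> `|v'| < r ->
  forall j, `|(M u v - M u' v - M u v' + M u' v') 0 j|
            <= K * `|u - u'| * `|v - v'|].
Proof.
pose U : normedModType R := ('rV[R]_n * 'rV[R]_n)%type.
pose e1 k : U := ('e_k, 0).
pose e2 k : U := (0, 'e_k).
have [dF cF] := F2.
pose G (mk : 'I_n * 'I_n) := 'D_(e2 mk.2) ('D_(e1 mk.1) F).
have bG mk : bounded_near (G mk) (nbhs (0 : 'rV[R]_n * 'rV[R]_n)).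
  by have [_ /(_ (e2 mk.2))/(_ 0)/cvg_bounded] := cF (e1 mk.1).
have exB mk : exists b : R, 0 < b /\ \forall x \near (0 : 'rV[R]_n * 'rV[R]_n), `|G mk x| < b.
  by have [b b0 Hb] := ex_strict_bound_gt0 (bG mk); exists b.
pose B mk := sval (cid (exB mk)).
have HB mk : 0 < B mk /\ \forall x \near (0 : 'rV[R]_n * 'rV[R]_n), `|G mk x| < B mk.
  exact: svalP (cid (exB mk)).
have /nbhs_ballP[r /= r0 Hr] : 
    nbhs (0 : 'rV[R]_n * 'rV[R]_n) [set x | forall mk, `|G mk x| < B mk].
  have HB2 mk : nbhs (0 : 'rV[R]_n * 'rV[R]_n) [set x | `|G mk x| < B mk] := (HB mk).2.
  exact: (filter_forall _ HB2).
have C0 : 0 <= \sum_k \sum_m B (m, k).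
  by apply: sumr_ge0 => k _; apply: sumr_ge0 => m _; rewrite ltW // (HB _).1.
(* The summand 1 keeps the constant positive even when the sum is empty. *)
exists r, (1 + \sum_k \sum_m B (m, k)); split=> //.
  by rewrite ltr_pwDl.
move=> u u' v v' ur u'r vr v'r j.
have [||[c d] /= /andP[c01 d01]] :=
  @mean_value_mixed _ _ _ F (u', v') (u - u', 0) (0, v - v') j.
- by [].
- by have [] := cF (u - u', 0).
rewrite /F /= !addr0 (addrC u' (u - u')) (addrC v' (v - v')) !subrK => E.
rewrite -/F in E.
have -> : (M u v - M u' v - M u v' + M u' v') 0 j
    = M u v 0 j - M u v' 0 j - M u' v 0 j + M u' v' 0 j by rewrite !mxE; ring.
rewrite {}E.
set q := (_, _) + _ + _.
(* Both components of the intermediate point are convex combinations of points of the ball. *)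
have qr : ball 0 r q.
  have cvx (x y : 'rV[R]_n) (t : R) : 0 <= t <= 1 -> `|x| < r -> `|y| < r ->
      `|y + t *: (x - y)| < r.
    move=> /andP[t0 t1] xr yr; have -> : y + t *: (x - y) = t *: x + (1 - t) *: y.
      by rewrite scalerBr scalerBl scale1r addrCA addrA.
    apply: (le_lt_trans (ler_normD _ _)); rewrite !normrZ ger0_norm// ger0_norm ?subr_ge0//.
    apply: (@le_lt_trans _ _ (Num.max `|x| `|y|)); last by rewrite gt_max xr.
    have X : `|x| <= Num.max `|x| `|y| by rewrite le_max lexx.
    have Y : `|y| <= Num.max `|x| `|y| by rewrite le_max lexx orbT.
    nra.
  split; rewrite -ball_normE /= /ball_ /= sub0r normrN scaler0 addr0.
    exact: cvx.
  exact: cvx.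
have E1 (x : 'rV[R]_n) : (x, 0) = ( \sum_m x 0 m *: e1 m : U).
  rewrite [RHS]surjective_pairing (big_morph fst (fun _ _ => erefl) erefl).
  rewrite (big_morph snd (fun _ _ => erefl) erefl) /= -row_sum_delta.
  by rewrite big1 // => m _; rewrite scaler0.
have E2 (x : 'rV[R]_n) : (0, x) = ( \sum_m x 0 m *: e2 m : U).
  rewrite [RHS]surjective_pairing (big_morph fst (fun _ _ => erefl) erefl).
  rewrite (big_morph snd (fun _ _ => erefl) erefl) /= -row_sum_delta.
  by rewrite big1 // => m _; rewrite scaler0.
have -> : 'D_(0, v - v') ('D_(u - u', 0) F) q
    = \sum_k (v - v') 0 k *: \sum_m (u - u') 0 m *: G (m, k) q.
  have dG : forall x, differentiable ('D_(u - u', 0) F) x by have [] := cF (u - u', 0).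
  rewrite (derive_sum_dir ((v - v') 0) e2 dG (E2 (v - v'))).
  apply: eq_bigr => k _; congr (_ *: _).
  have -> : 'D_(u - u', 0) F = \sum_m ((u - u') 0 m \*: 'D_(e1 m) F).
    by apply/funext => x; rewrite fct_sumE (derive_sum_dir ((u - u') 0) e1 dF (E1 (u - u'))).
  have ddF m : derivable ('D_(e1 m) F) q (e2 k).
    by apply: diff_derivable; have [] := cF (e1 m).
  rewrite derive_sum => [|m]; last exact: derivableZ.
  by apply: eq_bigr => m _; rewrite deriveZ.
rewrite summxE.
apply: (le_trans (ler_norm_sum _ _ _)).
apply: (@le_trans _ _ (\sum_k \sum_m (`|u - u'| * `|v - v'|) * B (m, k))).
  apply: ler_sum => k _.
  rewrite mxE summxE mulr_sumr (le_trans (ler_norm_sum _ _ _))//; apply: ler_sum => m _.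
  rewrite [X in _ * X]mxE !normrM mulrA; apply: ler_pM; rewrite ?mulr_ge0//.
    by rewrite mulrC; apply: ler_pM; rewrite ?coord_le_norm.
  by rewrite (le_trans (coord_le_norm _ _))// ltW//; exact: Hr.
rewrite -mulrA [leRHS]mulrC.
rewrite mulrDr mulr_sumr ler_wpDl ?mulr_ge0//.
by apply: ler_sum => k _; rewrite mulr_sumr.
Qed.
End LocalLipschitz.

(** * The Euclidean norm *)

Section EuclideanNorm.
#[local] Set Implicit Arguments.
#[local] Unset Strict Implicit.
Context {R : realType} {n : nat}.
Implicit Types x y : 'rV[R]_n.

Lemma enorm_ge0 x : 0 <= enorm x.
Proof. exact: sqrtr_ge0. Qed.

Lemma enorm_sqr x : enorm x ^+ 2 = \sum_j x 0 j ^+ 2.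
Proof. by rewrite sqr_sqrtr// sumr_ge0// => j _; exact: sqr_ge0. Qed.

Lemma le_enorm (c : R) x y : 0 <= c ->
  (forall j, `|x 0 j| <= c * `|y 0 j|) -> enorm x <= c * enorm y.
Proof.
move=> c0 xy; rewrite -(ler_pXn2r (n := 2)) ?nnegrE ?mulr_ge0 ?enorm_ge0//.
rewrite exprMn !enorm_sqr mulr_sumr; apply: ler_sum => j _.
rewrite -[X in X <= _]real_normK ?num_real// -(@real_normK _ (y 0 j)) ?num_real//.
by rewrite -exprMn ler_pXn2r ?nnegrE ?mulr_ge0.
Qed.

Lemma coord_le_enorm x j : `|x 0 j| <= enorm x.
Proof.
rewrite -(ler_pXn2r (n := 2)) ?nnegrE ?enorm_ge0// enorm_sqr real_normK ?num_real//.
by rewrite (bigD1 j)//= lerDl sumr_ge0// => i _; exact: sqr_ge0.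
Qed.

Lemma norm_le_enorm x : `|x| <= enorm x.
Proof.
rewrite [leLHS]mx_normrE; apply/bigmax_leP; split; first exact: enorm_ge0.
by move=> [i j] _ /=; rewrite (ord1 i) coord_le_enorm.
Qed.

Lemma enorm_le_card (c : R) x : 0 <= c -> (forall j, `|x 0 j| <= c) -> enorm x <= n%:R * c.
Proof.
move=> c0 xc; rewrite -(ler_pXn2r (n := 2)) ?nnegrE ?mulr_ge0 ?enorm_ge0// enorm_sqr.
apply: (@le_trans _ _ (\sum_(j < n) c ^+ 2)).
  by apply: ler_sum => j _; rewrite -real_normK ?num_real// ler_pXn2r ?nnegrE.
rewrite sumr_const card_ord -[X in X <= _]mulr_natl exprMn ler_wpM2r ?sqr_ge0// -natrX ler_nat.
by case: (n) => // m; rewrite -mulnn leq_pmull.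
Qed.

Lemma enormN x : enorm (- x) = enorm x.
Proof. by congr Num.sqrt; apply: eq_bigr => j _; rewrite mxE sqrrN. Qed.

Lemma enormB x y : enorm (x - y) = enorm (y - x).
Proof. by rewrite -enormN opprB. Qed.

Lemma enorm0 : enorm (0 : 'rV[R]_n) = 0.
Proof. by rewrite /enorm big1 ?sqrtr0// => j _; rewrite mxE expr0n. Qed.

Lemma enorm_eq0 x : enorm x = 0 -> x = 0.
Proof.
move=> x0; apply/rowP => j; rewrite mxE; apply/eqP; rewrite -normr_le0 -x0.
exact: coord_le_enorm.
Qed.

Lemma enormZ (c : R) x : enorm (c *: x) = `|c| * enorm x.
Proof.
rewrite /enorm -sqrtr_sqr -sqrtrM ?sqr_ge0// mulr_sumr; congr Num.sqrt.
by apply: eq_bigr => j _; rewrite mxE exprMn.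
Qed.

Lemma dot_le_enorm x y : \sum_j x 0 j * y 0 j <= enorm x * enorm y.
Proof.
have [x0|x0] := eqVneq (enorm x) 0.
  by rewrite (enorm_eq0 x0) enorm0 mul0r big1// => j _; rewrite mxE mul0r.
have [y0|y0] := eqVneq (enorm y) 0.
  by rewrite (enorm_eq0 y0) enorm0 mulr0 big1// => j _; rewrite mxE mulr0.
set A := enorm x in x0 *; set B := enorm y in y0 *.
have A0 : 0 < A by rewrite lt_neqAle eq_sym x0 enorm_ge0.
have B0 : 0 < B by rewrite lt_neqAle eq_sym y0 enorm_ge0.
(* The weights [B / A] and [A / B] make the termwise inequalities between arithmetic and geometric
   means add up to exactly [A * B]. *)
have -> : A * B = \sum_j (x 0 j ^+ 2 * (B / A / 2) + y 0 j ^+ 2 * (A / B / 2)).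
  by rewrite big_split /= -!mulr_suml -!enorm_sqr -/A -/B; field; rewrite x0 y0.
apply: ler_sum => j _.
have -> : x 0 j ^+ 2 * (B / A / 2) + y 0 j ^+ 2 * (A / B / 2)
  = x 0 j * y 0 j + (x 0 j * B - y 0 j * A) ^+ 2 / (2 * A * B) by field; rewrite x0 y0.
by rewrite lerDl divr_ge0 ?sqr_ge0// !mulr_ge0// ltW.
Qed.

Lemma enorm_sqrD x y :
  enorm (x + y) ^+ 2 = enorm x ^+ 2 + 2 * (\sum_j x 0 j * y 0 j) + enorm y ^+ 2.
Proof.
rewrite !enorm_sqr mulr_sumr -!big_split /=; apply: eq_bigr => j _.
by rewrite mxE; ring.
Qed.

Lemma enormD x y : enorm (x + y) <= enorm x + enorm y.
Proof.
rewrite -(ler_pXn2r (n := 2)) ?nnegrE ?addr_ge0 ?enorm_ge0// enorm_sqrD.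
have := dot_le_enorm x y; nra.
Qed.

Lemma enorm_dist x y z : enorm (x - z) <= enorm (x - y) + enorm (y - z).
Proof. by rewrite -[x - z](subrKA y) enormD. Qed.

End EuclideanNorm.

(** The passage to the limit [t -> 0], done by one test value: at [t = |x| / (2 C)], or [rho] if
    smaller, the bound is at most [|x| / 2]. It turns estimates for small dilates into exact
    identities. *)
Lemma le_linear_eq0 (R : realType) (x C rho : R) : 0 < rho ->
  (forall t, 0 < t -> t <= rho -> `|x| <= C * t) -> x = 0.
Proof.
move=> rho0 H; apply/eqP; rewrite -normr_le0 leNgt; apply/negP => x0.
have H1 := H _ rho0 (lexx _).
have C0 : 0 < C by rewrite -(pmulr_lgt0 _ rho0) (lt_le_trans x0).
have := H (Num.min rho (`|x| / (2 * C))).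
have T0 : 0 < `|x| / (2 * C) by rewrite divr_gt0 ?mulr_gt0.
rewrite lt_min rho0 T0 ge_min lexx /= => /(_ isT isT).
rewrite leNgt => /negP; apply.
apply: (@le_lt_trans _ _ (C * (`|x| / (2 * C)))).
  by rewrite ler_wpM2l ?(ltW C0)// ge_min lexx orbT.
have -> : C * (`|x| / (2 * C)) = `|x| / 2 by field; rewrite gt_eqF.
lra.
Qed.

(** * Dilations and the group law *)

Section Dilations.
#[local] Set Implicit Arguments.
#[local] Unset Strict Implicit.
Context {R : realType} {n : nat} (deg : 'I_n -> nat).
Implicit Types x y : 'rV[R]_n.

Lemma dilE (a : R) x j : dil deg a x 0 j = a ^+ deg j * x 0 j.
Proof. by rewrite mxE. Qed.

Lemma truncE i x j : trunc deg i x 0 j = if (deg j <= i)%N then x 0 j else 0.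
Proof. by rewrite mxE. Qed.

Lemma dil_dil (a b : R) x : dil deg a (dil deg b x) = dil deg (a * b) x.
Proof. by apply/rowP => j; rewrite !dilE mulrA exprMn. Qed.

Lemma dil1 x : dil deg 1 x = x.
Proof. by apply/rowP => j; rewrite dilE expr1n mul1r. Qed.

Lemma dilK (a : R) x : a != 0 -> dil deg a (dil deg a^-1 x) = x.
Proof. by move=> a0; rewrite dil_dil mulfV// dil1. Qed.

Lemma dilVK (a : R) x : a != 0 -> dil deg a^-1 (dil deg a x) = x.
Proof. by move=> a0; rewrite dil_dil mulVf// dil1. Qed.

Lemma dilD (a : R) x y : dil deg a (x + y) = dil deg a x + dil deg a y.
Proof. by apply/rowP => j; rewrite [RHS]mxE !dilE mxE mulrDr. Qed.

Lemma dilN (a : R) x : dil deg a (- x) = - dil deg a x.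
Proof. by apply/rowP => j; rewrite [RHS]mxE !dilE mxE mulrN. Qed.

Lemma dilB (a : R) x y : dil deg a (x - y) = dil deg a x - dil deg a y.
Proof. by rewrite dilD dilN. Qed.

Lemma trunc_dil i (a : R) x : trunc deg i (dil deg a x) = dil deg a (trunc deg i x).
Proof. by apply/rowP => j; rewrite dilE !truncE dilE; case: ifP; rewrite ?mulr0. Qed.

Lemma truncN i x : trunc deg i (- x) = - trunc deg i x.
Proof. by apply/rowP => j; rewrite [RHS]mxE !truncE mxE; case: ifP; rewrite ?oppr0. Qed.

Lemma truncD i x y : trunc deg i (x + y) = trunc deg i x + trunc deg i y.
Proof. by apply/rowP => j; rewrite [RHS]mxE !truncE mxE; case: ifP; rewrite ?addr0. Qed.

Lemma truncK i x : trunc deg i (trunc deg i x) = trunc deg i x.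
Proof. by apply/rowP => j; rewrite !truncE; case: (_ <= _)%N. Qed.

Lemma enorm_trunc i x : enorm (trunc deg i x) <= enorm x.
Proof.
rewrite -[leRHS]mul1r; apply: le_enorm => [|j]; first exact: ler01.
by rewrite truncE mul1r; case: ifP; rewrite ?normr0.
Qed.

Hypothesis deg_gt0 : forall j, (0 < deg j)%N.

Lemma dil_trunc1 (a : R) x : dil deg a (trunc deg 1 x) = a *: trunc deg 1 x.
Proof.
apply/rowP => j; rewrite dilE [RHS]mxE !truncE; case: ifP; rewrite ?mulr0// => dj.
by rewrite (_ : deg j = 1%N)//; apply/eqP; rewrite eqn_leq dj deg_gt0.
Qed.

Lemma enorm_dil_le (a : R) k x : 0 <= a <= 1 ->
  (forall j, (deg j < k)%N -> x 0 j = 0) -> enorm (dil deg a x) <= a ^+ k * enorm x.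
Proof.
move=> /andP[a0 a1] xk; apply: le_enorm => [|j]; first exact: exprn_ge0.
rewrite dilE normrM ger0_norm ?exprn_ge0//.
have [/xk ->|kj] := ltnP (deg j) k; first by rewrite normr0 !mulr0.
by rewrite ler_wpM2r// ler_wiXn2l.
Qed.

Lemma enorm_dil_le1 (a : R) x : 0 <= a <= 1 -> enorm (dil deg a x) <= a * enorm x.
Proof. by move=> a01; apply: (@enorm_dil_le a 1%N x a01) => j; rewrite ltnNge deg_gt0. Qed.

End Dilations.

(** * The group law: inversion, local estimates, compatibility with truncation *)

Section CarnotGroup.
#[local] Set Implicit Arguments.
#[local] Unset Strict Implicit.
Context {R : realType} {s n : nat} (G : carnotGroup R s n).
Implicit Types x y u v : 'rV[R]_n.
Local Notation deg := (cg_deg G).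
Local Notation mul := (cg_mul G).

Lemma deg_gt0 j : (0 < deg j)%N.
Proof. by have /andP[] := cg_deg_range G j. Qed.

Lemma deg_le_step j : (deg j <= s)%N.
Proof. by have /andP[] := cg_deg_range G j. Qed.

Lemma cg_mul0r x : mul x 0 = x.
Proof. by have := cg_exp G 1 0 x; rewrite addr0 scale0r !scale1r. Qed.

Lemma cg_mulNr x : mul x (- x) = 0.
Proof. by have := cg_exp G 1 (-1) x; rewrite subrr scale0r scale1r scaleN1r. Qed.

Lemma cg_mulNl x : mul (- x) x = 0.
Proof. by rewrite -[X in mul _ X]opprK cg_mulNr. Qed.

(** In exponential coordinates [x] and [- x] lie on one one-parameter subgroup, so their product is
    0. *)
Lemma cg_invE x : cg_inv G x = - x.
Proof. by rewrite -[LHS]cg_mul0r -(cg_mulNr x) cg_mulA cg_mulVl cg_mul0l. Qed.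

Lemma cg_mulKV x y : mul x (mul (- x) y) = y.
Proof. by rewrite cg_mulA cg_mulNr cg_mul0l. Qed.

Lemma cg_mulVK x y : mul (- x) (mul x y) = y.
Proof. by rewrite cg_mulA cg_mulNl cg_mul0l. Qed.

Lemma cg_oppM x y : - mul x y = mul (- y) (- x).
Proof.
rewrite -[RHS](cg_mulVK (mul x y)) -[X in _ = mul _ X]cg_mulA cg_mulKV cg_mulNr.
by rewrite cg_mul0r.
Qed.

Lemma trunc_step x : trunc deg s x = x.
Proof. by apply/rowP => j; rewrite truncE deg_le_step. Qed.

(** A quantitative form of the fact that the law differs from addition by a term that is bilinear up
    to a constant. Setting one argument to 0 gives [mul_diffl] and [mul_diffr]. *)
Definition mul_lipschitz (r K : R) := forall u u' v v',
  enorm u < r -> enorm u' < r -> enorm v < r -> enorm v' < r ->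
  enorm (mul u v - mul u' v - mul u v' + mul u' v')
    <= K * enorm (u - u') * enorm (v - v').

Lemma mul_lipschitzP : exists r K : R, [/\ 0 < r, 0 < K & mul_lipschitz r K].
Proof.
have [r [K [r0 K0 H]]] := mixed_difference_bound _ (cg_smooth_mul G 2%N).
exists r, (n.+1%:R * K); split=> //; first by rewrite mulr_gt0.
move=> u u' v v' ur u'r vr v'r.
have L x : enorm x < r -> `|x| < r by apply: le_lt_trans; exact: norm_le_enorm.
apply: (@le_trans _ _ (n%:R * (K * enorm (u - u') * enorm (v - v')))).
  apply: enorm_le_card => [|j]; first by rewrite !mulr_ge0 ?enorm_ge0 ?(ltW K0).
  apply: (le_trans (H _ _ _ _ (L _ ur) (L _ u'r) (L _ vr) (L _ v'r) j)).
  rewrite -!mulrA ler_wpM2l ?(ltW K0)// ler_pM ?norm_le_enorm//.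
rewrite -!mulrA ler_wpM2r ?ler_nat//.
by rewrite !mulr_ge0 ?enorm_ge0 ?(ltW K0).
Qed.

Section LocalEstimates.
Variables (r K : R).
Hypotheses (r0 : 0 < r) (K0 : 0 < K) (mulL : mul_lipschitz r K).

Lemma mul_diffl u u' v : enorm u < r -> enorm u' < r -> enorm v < r ->
  enorm (mul u v - mul u' v - (u - u')) <= K * enorm (u - u') * enorm v.
Proof.
move=> ur u'r vr; have := mulL ur u'r vr; move=> /(_ 0).
by rewrite enorm0 subr0 !cg_mul0r opprB addrA addrAC; apply.
Qed.

Lemma mul_diffr u v v' : enorm u < r -> enorm v < r -> enorm v' < r ->
  enorm (mul u v - mul u v' - (v - v')) <= K * enorm u * enorm (v - v').
Proof.
move=> ur vr v'r; have := mulL ur; move=> /(_ 0 v v').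
have -> : mul u v - mul u v' - (v - v') = mul u v - v - mul u v' + v'.
  by apply/rowP => j; rewrite !mxE; ring.
by rewrite enorm0 subr0 !cg_mul0l; apply.
Qed.

Lemma small_dil u : exists2 rho : R, 0 < rho & forall t, 0 < t -> t <= rho ->
  [/\ 0 <= t <= 1, enorm (dil deg t u) < r & enorm (dil deg t u) <= t * enorm u].
Proof.
have u0 := enorm_ge0 u.
(* The [+ 1] avoids a division by zero and makes [t * enorm u < r] strict. *)
exists (Num.min 1 (r / (enorm u + 1))).
  by rewrite lt_min ltr01 divr_gt0// ltr_pwDr.
move=> t t0; rewrite le_min ler_pdivlMr ?ltr_pwDr// => /andP[t1 tr].
have t01 : 0 <= t <= 1 by rewrite (ltW t0).
have H := enorm_dil_le1 (@deg_gt0) u t01; split => //.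
by apply: (le_lt_trans H); nra.
Qed.

(* A coordinate of degree [d] of the law is [d]-homogeneous under dilations, so
   the local Lipschitz estimates at dilates by [t -> 0] force identities that
   hold globally. *)
Lemma mul_deg1 u v j : deg j = 1%N -> mul u v 0 j = u 0 j + v 0 j.
Proof.
move=> dj; apply/eqP; rewrite -subr_eq0; apply/eqP.
have [r1 r10 H1] := small_dil u; have [r2 r20 H2] := small_dil v.
apply: (@le_linear_eq0 _ _ (K * enorm u * enorm v) (Num.min r1 r2)).
  by rewrite lt_min r10.
move=> t t0; rewrite le_min => /andP[/(H1 _ t0)[t01 ur ut] /(H2 _ t0)[_ vr vt]].
have := mul_diffl ur _ vr (u' := 0); rewrite enorm0 cg_mul0l subr0 => /(_ r0).
rewrite -cg_dil//= -!dilB => /(le_trans (coord_le_enorm _ j)).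
rewrite !(dilE, mxE) dj expr1 normrM gtr0_norm// => H.
rewrite -(ler_pM2l t0) (_ : _ - (_ + _) = mul u v 0 j - v 0 j - u 0 j); last by ring.
apply: (le_trans H).
rewrite (_ : t * _ = K * (t * enorm u * (t * enorm v))); last by ring.
by rewrite -mulrA ler_wpM2l ?(ltW K0)// ler_pM ?enorm_ge0.
Qed.

(** Truncation alters [v] only in degrees above [k], so after dilation by [t] the change is of order
    [t ^+ k.+1]. A coordinate of degree at most [k] of the product keeps a factor of at least
    [t ^+ k]; dividing and letting [t -> 0] gives equality. *)
Lemma mul_truncr k u v : trunc deg k (mul u v) = trunc deg k (mul u (trunc deg k v)).
Proof.
apply/rowP => j; rewrite !truncE; case: ifP => // dj.
apply/eqP; rewrite -subr_eq0; apply/eqP; set v' := trunc deg k v.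
have vv' i : (deg i <= k)%N -> v' 0 i = v 0 i by rewrite truncE => ->.
clearbody v'; have [r1 r10 H1] := small_dil u; have [r2 r20 H2] := small_dil v.
have [r3 r30 H3] := small_dil v'.
apply: (@le_linear_eq0 _ _ (K * enorm u * enorm (v - v')) (Num.min r1 (Num.min r2 r3))).
  by rewrite !lt_min r10 r20.
move=> t t0; rewrite !le_min.
move=> /and3P[/(H1 _ t0)[t01 ur ut] /(H2 _ t0)[_ vr _] /(H3 _ t0)[_ v'r _]].
have := mul_diffr ur vr v'r.
rewrite -!cg_dil//= -!dilB => /(le_trans (coord_le_enorm _ j)).
rewrite !(dilE, mxE) vv'// subrr subr0 normrM gtr0_norm ?exprn_gt0// => H.
have Hd : enorm (dil deg t (v - v')) <= t ^+ k.+1 * enorm (v - v').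
  apply: enorm_dil_le => // i; rewrite ltnS => ik.
  by rewrite !mxE vv'// subrr.
have tk : 0 < t ^+ k by rewrite exprn_gt0.
rewrite -(ler_pM2l tk); apply: (@le_trans _ _ (t ^+ deg j * `|mul u v 0 j - mul u v' 0 j|)).
  by case/andP: t01 => *; rewrite ler_wpM2r// ler_wiXn2l// ltW.
apply: (le_trans H).
have ut1 : enorm (dil deg t u) <= enorm u.
  by case/andP: t01 => _ t1; apply: (le_trans ut); rewrite ler_piMl ?enorm_ge0.
rewrite (_ : t ^+ k * _ = K * (enorm u * (t ^+ k.+1 * enorm (v - v')))); last first.
  by rewrite exprS; ring.
by rewrite -mulrA ler_wpM2l ?(ltW K0)// ler_pM ?enorm_ge0.
Qed.

End LocalEstimates.

Lemma cg_mul_deg1 u v j : deg j = 1%N -> mul u v 0 j = u 0 j + v 0 j.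
Proof. by have [r [K [r0 K0 L]]] := mul_lipschitzP; exact: mul_deg1 L _ _ _. Qed.

(** Inversion is negation and reverses products, so truncation of the right factor yields truncation
    of the left one. This makes the quotient maps homomorphisms. *)
Lemma trunc_mul k u v :
  trunc deg k (mul u v) = trunc deg k (mul (trunc deg k u) (trunc deg k v)).
Proof.
have [r [K [r0 K0 L]]] := mul_lipschitzP.
rewrite (mul_truncr r0 K0 L); apply: oppr_inj; rewrite -!truncN !cg_oppM.
by rewrite (mul_truncr r0 K0 L) truncN.
Qed.

Lemma trunc1_mul u v : trunc deg 1 (mul u v) = trunc deg 1 u + trunc deg 1 v.
Proof.
apply/rowP => j; rewrite [RHS]mxE !truncE; case: ifP; rewrite ?addr0// => dj.
by rewrite cg_mul_deg1//; apply/eqP; rewrite eqn_leq dj deg_gt0.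
Qed.

End CarnotGroup.

(** * The Hebisch-Sikora norm *)

Lemma bernoulli_le (R : realFieldType) (t : R) k : 0 <= t <= 1 ->
  1 - k%:R * t <= (1 - t) ^+ k.
Proof.
move=> /andP[t0 t1]; elim: k => [|k IH]; first by rewrite mul0r subr0 expr0.
rewrite exprS -natr1; apply: (@le_trans _ _ ((1 - t) * (1 - k%:R * t))).
  have : 0 <= k%:R * t * t by rewrite !mulr_ge0.
  lra.
by rewrite ler_wpM2l// subr_ge0.
Qed.

Section HebischSikora.
#[local] Set Implicit Arguments.
#[local] Unset Strict Implicit.
Context {R : realType} {n : nat} (deg : 'I_n -> nat).
Variables (s : nat) (eta : R).
Hypotheses (deg_gt0 : forall j, (0 < deg j)%N) (deg_le : forall j, (deg j <= s)%N).
Hypotheses (s_gt0 : (0 < s)%N) (eta0 : 0 < eta).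
Implicit Types (x y w : 'rV[R]_n) (mu : R).
Local Notation N := (NHS deg eta).

Lemma enorm_dil_ge (a : R) k x : 0 <= a <= 1 ->
  (forall j, (k < deg j)%N -> x 0 j = 0) -> a ^+ k * enorm x <= enorm (dil deg a x).
Proof.
move=> /andP[a0 a1] xk.
have -> : a ^+ k * enorm x = enorm (a ^+ k *: x).
  by rewrite enormZ ger0_norm// exprn_ge0.
rewrite -[leRHS]mul1r; apply: le_enorm => [|j]; first exact: ler01.
rewrite mul1r dilE mxE !normrM (ger0_norm (exprn_ge0 _ a0)) (ger0_norm (exprn_ge0 _ a0)).
have [/xk ->|jk] := ltnP k (deg j); first by rewrite normr0 !mulr0.
by rewrite ler_wpM2r// ler_wiXn2l.
Qed.

Lemma dil_ratio (a b : R) x : 0 < a -> 0 < b ->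
  dil deg b^-1 x = dil deg (a / b) (dil deg a^-1 x).
Proof. by move=> a0 b0; rewrite dil_dil mulrAC mulfV ?gt_eqF// mul1r. Qed.

Lemma NHS_nonempty x : [set l | 0 < l /\ enorm (dil deg l^-1 x) < eta] !=set0.
Proof.
have x0 := enorm_ge0 x.
(* The witness is at least 1, so dilating by its inverse contracts at least linearly. *)
have l1 : 1 <= 1 + enorm x / eta by rewrite lerDl divr_ge0// ltW.
have l0 : 0 < 1 + enorm x / eta by rewrite (lt_le_trans ltr01).
exists (1 + enorm x / eta) => /=; split => //.
have := enorm_dil_le1 deg_gt0 (a := (1 + enorm x / eta)^-1) x.
rewrite invr_ge0 (ltW l0) invf_le1// l1 => /(_ isT) /le_lt_trans; apply.
rewrite mulrC ltr_pdivrMr// mulrDr mulr1 mulrCA mulfV ?gt_eqF//.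
by rewrite mulr1 ltrDr.
Qed.

Lemma NHS_lbound x : has_lbound [set l | 0 < l /\ enorm (dil deg l^-1 x) < eta].
Proof. by exists 0 => l [/ltW]. Qed.

Lemma NHS_ge0 x : 0 <= N x.
Proof. by apply: lb_le_inf; [exact: NHS_nonempty|move=> l [/ltW]]. Qed.

(** The infimum is defined by a strict inequality, but replacing [mu] by [mu + e] contracts
    strictly, so the closed one suffices. *)
Lemma NHS_le x mu : 0 < mu -> enorm (dil deg mu^-1 x) <= eta -> N x <= mu.
Proof.
move=> mu0 H; apply/ler_addgt0Pr => e e0; apply: ge_inf; first exact: NHS_lbound.
have me : 0 < mu + e by rewrite addr_gt0.
split => //; rewrite (dil_ratio x mu0 me).
have lq : 0 <= mu / (mu + e) <= 1.
  by rewrite divr_ge0 ?ler_pdivrMr ?mul1r ?lerDl ?ltW.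
apply: (le_lt_trans (enorm_dil_le1 deg_gt0 _ lq)).
rewrite mulrAC ltr_pdivrMr//.
have : mu * enorm (dil deg mu^-1 x) <= mu * eta by rewrite ler_pM2l.
have : 0 < e * eta by rewrite mulr_gt0.
lra.
Qed.

(** For each [t] in (0, 1) some admissible [l] lies below [mu / (1 - t)]. Returning from
    [mu / (1 - t)] to [mu] costs at most a factor [(1 - t) ^+ s], which Bernoulli's inequality
    bounds by [1 - s t]; then [t] tends to 0. *)
Lemma le_NHS x mu : 0 < mu -> N x <= mu -> enorm (dil deg mu^-1 x) <= eta.
Proof.
move=> mu0 H; set E := enorm _.
have E0 : 0 <= E by exact: enorm_ge0.
have B t : 0 < t -> t < 1 -> (1 - s%:R * t) * E <= eta.
  move=> t0 t1; have t'0 : 0 < 1 - t by lra.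
  have m'0 : 0 < mu / (1 - t) by rewrite divr_gt0.
  have : N x < mu / (1 - t) by rewrite (le_lt_trans H)// ltr_pdivlMr// mulrBr mulr1; nra.
  move=> /inf_lt[|l [l0 ll] lm]; first exact: NHS_nonempty.
  have : enorm (dil deg (mu / (1 - t))^-1 x) <= eta.
    rewrite (dil_ratio x l0 m'0); apply: le_trans (ltW ll).
    have lq : 0 <= l / (mu / (1 - t)) <= 1.
      by rewrite divr_ge0 ?(ltW l0) ?(ltW m'0)//= ler_pdivrMr// mul1r ltW.
    apply: (le_trans (enorm_dil_le1 deg_gt0 _ lq)).
    by case/andP: lq => _ lq; rewrite ler_piMl ?enorm_ge0.
  rewrite invf_div -dil_dil.
  have t01 : 0 <= 1 - t <= 1 by apply/andP; split; lra.
  have D := @enorm_dil_ge (1 - t) s (dil deg mu^-1 x) t01.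
  apply: le_trans; apply: le_trans (D _) => [|j]; last by rewrite ltnNge deg_le.
  by rewrite ler_wpM2r// bernoulli_le// !ltW.
apply/ler_addgt0Pr => e e0.
have sE : 0 <= s%:R * E by rewrite mulr_ge0.
have d0 : 0 < 2 * e + s%:R * E by rewrite ltr_pwDl ?mulr_gt0.
(* This [t] satisfies [s t E <= e]; the [2 * e] keeps it below 1 even if [s E = 0]. *)
have := B (e / (2 * e + s%:R * E)); rewrite divr_gt0// ltr_pdivrMr// mul1r.
have -> : e < 2 * e + s%:R * E by lra.
move=> /(_ isT isT).
have : s%:R * (e / (2 * e + s%:R * E)) * E <= e.
  rewrite (_ : _ * _ * E = e * (s%:R * E / (2 * e + s%:R * E))); last by ring.
  by rewrite ler_piMr ?(ltW e0)// ler_pdivrMr// mul1r lerDr mulr_ge0// ltW.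
lra.
Qed.

(** Since [N y] may vanish, comparison is made through positive [mu] above it, by which one can
    dilate. *)
Lemma NHS_le_lim x y (c : R) : 0 <= c ->
  (forall mu, 0 < mu -> N y <= mu -> N x <= c * mu) -> N x <= c * N y.
Proof.
move=> c0 H; apply/ler_addgt0Pr => e e0.
have d0 : 0 < e / (c + 1) by rewrite divr_gt0// ltr_wpDl.
apply: le_trans (H (N y + e / (c + 1)) _ _) _.
- by rewrite ltr_wpDl// NHS_ge0.
- by rewrite lerDl ltW.
rewrite mulrDr lerD2l mulrCA ler_piMr ?(ltW e0)//.
by rewrite ler_pdivrMr ?ltr_wpDl// mul1r lerDl.
Qed.

Lemma NHS_dil (a : R) x : 0 < a -> N (dil deg a x) = a * N x.
Proof.
have D b y : 0 < b -> N (dil deg b y) <= b * N y.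
  move=> b0; apply: NHS_le_lim => [|mu mu0 H]; first exact: ltW.
  apply: NHS_le; first by rewrite mulr_gt0.
  by rewrite invfM mulrC -dil_dil dilVK ?gt_eqF//; exact: le_NHS.
move=> a0; apply/eqP; rewrite eq_le D//=.
by rewrite -ler_pdivlMl// -{1}(dilVK deg x (lt0r_neq0 a0)) D// invr_gt0.
Qed.

Lemma NHS_trunc i x : N (trunc deg i x) <= N x.
Proof.
rewrite -[leRHS]mul1r; apply: NHS_le_lim => // mu mu0 H; rewrite mul1r.
apply: NHS_le => //; rewrite -trunc_dil.
exact: le_trans (enorm_trunc _ _ _) (le_NHS mu0 H).
Qed.

Lemma NHS_eq0 x : N x = 0 -> x = 0.
Proof.
move=> x0; apply: enorm_eq0; apply: (@le_linear_eq0 _ _ eta 1) => // t t0 t1.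
rewrite ger0_norm ?enorm_ge0// mulrC -{1}(dilK deg x (lt0r_neq0 t0)).
apply: (le_trans (enorm_dil_le1 deg_gt0 _ _)); first by rewrite (ltW t0).
by rewrite ler_pM2l// le_NHS// x0 ltW.
Qed.

(** Converts a Euclidean gain into a gain in [N]. Dilation by [1 - d] multiplies the squared length
    by at least [(1 - d) ^+ (2 * s)], hence by at least [1 - 2 s d], and [d = c / (2 s)] makes this
    [1 - c]. *)
Lemma NHS_improve x (c : R) : 0 <= c <= 1 ->
  enorm x ^+ 2 <= eta ^+ 2 * (1 - c) -> N x <= 1 - c / (2 * s%:R).
Proof.
move=> /andP[c0 c1] H.
have s0 : 0 < s%:R :> R by rewrite ltr0n.
have s1 : 1 <= s%:R :> R by rewrite ler1n.
set d := c / (2 * s%:R).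
have d0 : 0 <= d by rewrite divr_ge0// mulr_ge0// ltW.
have d1 : d <= 1 / 2 by rewrite /d ler_pdivrMr ?mulr_gt0//; lra.
have m0 : 0 < 1 - d by lra.
have B : 1 - c <= (1 - d) ^+ (2 * s).
  apply: le_trans (bernoulli_le _ _ (2 * s) _); last by apply/andP; split; lra.
  by rewrite natrM /d mulrC divfK ?mulf_neq0 ?gt_eqF.
apply: NHS_le => //.
have D := @enorm_dil_ge (1 - d) s (dil deg (1 - d)^-1 x).
move: D; rewrite dilK ?gt_eqF// => D.
have {}D : (1 - d) ^+ s * enorm (dil deg (1 - d)^-1 x) <= enorm x.
  by apply: D => [|j]; [apply/andP; split; lra|rewrite ltnNge deg_le].
rewrite -(ler_pXn2r (n := 2)) ?nnegrE ?enorm_ge0 ?(ltW eta0)//.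
have P0 : 0 < (1 - d) ^+ (2 * s) by rewrite exprn_gt0.
rewrite -(ler_pM2l P0) mulnC exprM -exprMn.
apply: (@le_trans _ _ (enorm x ^+ 2)).
  by rewrite ler_pXn2r ?nnegrE ?mulr_ge0 ?exprn_ge0 ?enorm_ge0 ?(ltW m0).
by apply: (le_trans H); rewrite mulrC -exprM mulnC ler_wpM2r// sqr_ge0.
Qed.

(** If the normalised vector were strictly inside the sphere, [NHS_improve] would push its norm
    below 1. *)
Lemma NHS_unit x : 0 < N x -> enorm (dil deg (N x)^-1 x) = eta.
Proof.
move=> x0; apply/eqP; rewrite eq_le le_NHS//=; set z := dil _ _ _.
have z1 : N z = 1 by rewrite NHS_dil ?invr_gt0// mulVf ?gt_eqF.
rewrite leNgt; apply/negP => ze.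
have q0 : 0 <= enorm z / eta by rewrite divr_ge0 ?enorm_ge0// ltW.
have q1 : enorm z / eta < 1 by rewrite ltr_pdivrMr// mul1r.
have := @NHS_improve z (1 - (enorm z / eta) ^+ 2).
have -> : 0 <= 1 - (enorm z / eta) ^+ 2 <= 1 by apply/andP; split; nra.
have -> : eta ^+ 2 * (1 - (1 - (enorm z / eta) ^+ 2)) = enorm z ^+ 2.
  by field; rewrite gt_eqF.
rewrite z1 lexx => /(_ isT isT); rewrite leNgt => /negP; apply.
by rewrite ltrBlDr ltrDl divr_gt0 ?mulr_gt0 ?ltr0n//; nra.
Qed.

(** Dilation by [B^-1] first brings [w] into the ball of radius [eta], so its norm [m] is at most 1.
    In degrees up to [i], dilation by [m] shrinks a vector of length [eta] to no less than
    [m ^+ i * eta]. *)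
Lemma NHS_expr_le i (B : R) w : 1 <= B -> trunc deg i w = w ->
  enorm w <= B * eta -> (0 < i)%N -> N w ^+ i <= B ^+ i * (enorm w / eta).
Proof.
move=> B1 wi wB i0; have B0 : 0 < B by lra.
have RHS0 : 0 <= enorm w / eta by rewrite divr_ge0 ?enorm_ge0// ltW.
rewrite -{1}(dilK deg w (lt0r_neq0 B0)) NHS_dil// exprMn ler_pM2l ?exprn_gt0//.
set w0 := dil deg B^-1 w; set m := N w0.
have w0B : enorm w0 <= B^-1 * enorm w.
  by apply: enorm_dil_le1 => //; rewrite invr_ge0 (ltW B0) invf_le1.
have m1 : m <= 1.
  by apply: NHS_le => //; rewrite invr1 dil1 (le_trans w0B)// mulrC ler_pdivrMr// mulrC.
have : 0 <= m by exact: NHS_ge0.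
rewrite le_eqVlt => /orP[/eqP <-|m0]; first by rewrite expr0n gtn_eqF.
have z1 := NHS_unit m0; rewrite -/m in z1; set z := dil deg m^-1 w0 in z1.
have zi j : (i < deg j)%N -> z 0 j = 0.
  by rewrite !dilE -wi truncE ltnNge => /negbTE ->; rewrite !mulr0.
have := @enorm_dil_ge m i z; rewrite (ltW m0) m1 z1 dilK ?gt_eqF// => /(_ isT zi) H.
rewrite ler_pdivlMr//; apply: (le_trans H); apply: (le_trans w0B).
by rewrite ler_piMl ?enorm_ge0// invf_le1.
Qed.

End HebischSikora.

(** * Uniform convexity of small Euclidean balls *)

Section Convexity.
#[local] Set Implicit Arguments.
#[local] Unset Strict Implicit.
Context {R : realType} {s n : nat} (G : carnotGroup R s n).
Variables (r K eta : R).
Hypotheses (r0 : 0 < r) (K0 : 0 < K) (mulL : mul_lipschitz G r K).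
Hypotheses (eta0 : 0 < eta) (eta_r : eta < r) (eta_K : K * eta <= 20^-1).
Implicit Types x y u v w : 'rV[R]_n.
Local Notation deg := (cg_deg G).
Local Notation mul := (cg_mul G).
Local Notation pr := (trunc deg 1).

(** The quantity [Q] of the overview; it vanishes exactly when [x] and [y] are one and the same
    horizontal vector. *)
Definition defect x y : R :=
  enorm (pr x - pr y) ^+ 2 + (enorm (x - pr x) ^+ 2 + enorm (y - pr y) ^+ 2).

Lemma defect_ge0 x y : 0 <= defect x y.
Proof. by rewrite !addr_ge0 ?sqr_ge0. Qed.

(** The right side equals [t^2 a^2 + (1 - t)^2 b^2]. The weights [t^d] and [(1 - t)^d] have sum at
    most 1, so convexity of the square applies, and they are at most [t^2] and [(1 - t)^2]. *)
Lemma coord_convex (t a b : R) d : 0 <= t <= 1 -> (1 < d)%N ->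
  (t ^+ d * a + (1 - t) ^+ d * b) ^+ 2
    <= t * a ^+ 2 + (1 - t) * b ^+ 2 - t * (1 - t) * (a ^+ 2 + b ^+ 2).
Proof.
move=> /andP[t0 t1] d1; have t'0 : 0 <= 1 - t by lra.
have t'1 : 1 - t <= 1 by lra.
have p0 : 0 <= t ^+ d by rewrite exprn_ge0.
have q0 : 0 <= (1 - t) ^+ d by rewrite exprn_ge0.
have p2 : t ^+ d <= t ^+ 2 by rewrite ler_wiXn2l.
have q2 : (1 - t) ^+ d <= (1 - t) ^+ 2 by rewrite ler_wiXn2l.
set p := t ^+ d in p0 p2 *; set q := (1 - t) ^+ d in q0 q2 *.
have pq : p + q <= 1 by nra.
have A : (p * a + q * b) ^+ 2 <= p * a ^+ 2 + q * b ^+ 2.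
  have : 0 <= p * q * (a - b) ^+ 2 by rewrite mulr_ge0 ?sqr_ge0// mulr_ge0.
  have : 0 <= (1 - p - q) * (p * a ^+ 2 + q * b ^+ 2).
    by apply: mulr_ge0; [lra|rewrite addr_ge0// mulr_ge0// sqr_ge0].
  lra.
apply: (le_trans A).
have : p * a ^+ 2 <= t ^+ 2 * a ^+ 2 by rewrite ler_wpM2r ?sqr_ge0.
have : q * b ^+ 2 <= (1 - t) ^+ 2 * b ^+ 2 by rewrite ler_wpM2r ?sqr_ge0.
lra.
Qed.

(** Coordinate by coordinate: in degree 1 it is an identity with gain [t (1 - t) (a - b)^2], in
    higher degree it is [coord_convex]. *)
Lemma enorm_dil_convex x y (t : R) : 0 <= t <= 1 ->
  enorm (dil deg t x + dil deg (1 - t) y) ^+ 2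
    <= t * enorm x ^+ 2 + (1 - t) * enorm y ^+ 2 - t * (1 - t) * defect x y.
Proof.
move=> t01; rewrite /defect !enorm_sqr -!big_split /= !mulr_sumr -sumrN -!big_split /=.
apply: ler_sum => j _; rewrite 2!mxE.
rewrite [dil _ _ y 0 j]dilE ![in X in _ <= X](mxE, truncE).
have [d1|d1] := leqP (deg j) 1.
  rewrite (_ : deg j = 1%N); last by apply/eqP; rewrite eqn_leq d1 deg_gt0.
  by rewrite !expr1 le_eqVlt; apply/orP; left; apply/eqP; ring.
by rewrite !subr0 expr0n/= add0r; exact: coord_convex.
Qed.

Definition mul_rest u v := mul u v - (u + v).

(** The law is additive in degree 1, so the remainder is vertical and pairs only with the vertical
    part of [w]. *)
Lemma mul_rest_dot_le w u v :
  \sum_j w 0 j * mul_rest u v 0 j <= enorm (w - pr w) * enorm (mul_rest u v).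
Proof.
apply: le_trans (dot_le_enorm _ _); apply: ler_sum => j _.
rewrite [(w - pr w) 0 j]mxE [(- pr w) 0 j]mxE truncE.
have [d1|d1] := leqP (deg j) 1; last by rewrite subr0.
rewrite !mxE cg_mul_deg1; first by rewrite !subrr mulr0 mul0r.
by apply/eqP; rewrite eqn_leq d1 deg_gt0.
Qed.

(* On one-parameter subgroups the law is additive, so the remainder only sees
   the distance from [x] and [y] to a common horizontal direction. *)
Lemma mul_rest_le x y (t : R) : 0 <= t <= 1 -> enorm x <= eta -> enorm y <= eta ->
  enorm (mul_rest (dil deg t x) (dil deg (1 - t) y))
  <= K * eta * (t * (1 - t)) *
     (enorm (x - pr x) + enorm (y - pr y) + enorm (pr x - pr y)).
Proof.
move=> t01 xe ye; have /andP[t0 t1] := t01.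
have t'0 : 0 <= 1 - t by lra.
have t'01 : 0 <= 1 - t <= 1 by apply/andP; split; lra.
have Xe : enorm (pr x) <= eta by exact: le_trans (enorm_trunc _ _ _) xe.
have Ye : enorm (pr y) <= eta by exact: le_trans (enorm_trunc _ _ _) ye.
have lt_r (a : R) (z : 'rV[R]_n) : 0 <= a <= 1 -> enorm z <= eta -> enorm (a *: z) < r.
  move=> /andP[a0 a1] ze; rewrite enormZ ger0_norm//; apply: le_lt_trans eta_r.
  by apply: le_trans ze; rewrite ler_piMl ?enorm_ge0.
have dlt_r (a : R) (z : 'rV[R]_n) : 0 <= a <= 1 -> enorm z <= eta -> enorm (dil deg a z) < r.
  move=> a01 ze; apply: le_lt_trans (lt_r _ _ a01 ze).
  rewrite enormZ ger0_norm; last by case/andP: a01.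
  exact: (enorm_dil_le1 (deg_gt0 G) _ a01).
set u := dil deg t x; set v := dil deg (1 - t) y.
(* Telescoping: [u] is moved to [u0], [v] to [v0], then [v0] to [v1]. The last pair lies on one line
   through 0, where the remainder vanishes. *)
pose u0 := t *: pr x; pose v0 := (1 - t) *: pr y; pose v1 := (1 - t) *: pr x.
have E1 : mul u0 v1 = u0 + v1 by rewrite /u0 /v1 cg_exp -scalerDl.
have -> : mul_rest u v = (mul u v - mul u0 v - (u - u0))
   + (mul u0 v - mul u0 v0 - (v - v0)) + (mul u0 v0 - mul u0 v1 - (v0 - v1)).
  by rewrite E1 /mul_rest; apply/rowP => j; rewrite !mxE; ring.
have ur : enorm u < r by exact: dlt_r.
have vr : enorm v < r by exact: dlt_r.
have u0r : enorm u0 < r by exact: lt_r.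
have v0r : enorm v0 < r by exact: lt_r.
have v1r : enorm v1 < r by exact: lt_r.
have H1 := mul_diffl r0 mulL ur u0r vr.
have H2 := mul_diffr r0 mulL u0r vr v0r.
have H3 := mul_diffr r0 mulL u0r v0r v1r.
have uu0 : enorm (u - u0) <= t * enorm (x - pr x).
  rewrite /u /u0 -(dil_trunc1 (deg_gt0 G)) -dilB.
  exact: (enorm_dil_le1 (deg_gt0 G) _ t01).
have vv0 : enorm (v - v0) <= (1 - t) * enorm (y - pr y).
  rewrite /v /v0 -(dil_trunc1 (deg_gt0 G)) -dilB.
  exact: (enorm_dil_le1 (deg_gt0 G) _ t'01).
have v01 : enorm (v0 - v1) = (1 - t) * enorm (pr x - pr y).
  by rewrite /v0 /v1 -scalerBr enormZ ger0_norm// enormB.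
have vle : enorm v <= (1 - t) * eta.
  apply: (le_trans (enorm_dil_le1 (deg_gt0 G) _ t'01)).
  by rewrite ler_wpM2l.
have u0le : enorm u0 <= t * eta by rewrite enormZ ger0_norm// ler_wpM2l.
have P a b a' b' : 0 <= a -> 0 <= b -> a <= a' -> b <= b' -> K * a * b <= K * (a' * b').
  by move=> ? ? ? ?; rewrite -mulrA ler_wpM2l ?(ltW K0)// ler_pM.
have {}H1 := le_trans H1 (P _ _ _ _ (enorm_ge0 _) (enorm_ge0 _) uu0 vle).
have {}H2 := le_trans H2 (P _ _ _ _ (enorm_ge0 _) (enorm_ge0 _) u0le vv0).
have {}H3 := le_trans H3 (P _ _ _ _ (enorm_ge0 _) (enorm_ge0 _) u0le (lexx _)).
rewrite v01 in H3.
apply: (le_trans (enormD _ _)); apply: (le_trans (lerD (enormD _ _) (lexx _))).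
apply: (le_trans (lerD (lerD H1 H2) H3)).
by rewrite le_eqVlt; apply/orP; left; apply/eqP; ring.
Qed.

(** [enorm_dil_convex] gains [t (1 - t) Q]. As [K * eta <= 1 / 20] and [(a + b + c)^2 <= 3 Q], the
    cross term costs at most 6/20 and the squared remainder at most 3/20 of that gain, so half of it
    survives. *)
Lemma enorm_mul_convex x y (t : R) : 0 <= t <= 1 -> enorm x <= eta -> enorm y <= eta ->
  enorm (mul (dil deg t x) (dil deg (1 - t) y)) ^+ 2
    <= eta ^+ 2 - t * (1 - t) / 2 * defect x y.
Proof.
move=> t01 xe ye; have /andP[t0 t1] := t01.
set u := dil deg t x; set v := dil deg (1 - t) y.
have -> : mul u v = (u + v) + mul_rest u v by rewrite addrC subrK.
rewrite enorm_sqrD.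
have W := enorm_dil_convex x y t01; rewrite -/u -/v in W.
have P := mul_rest_le t01 xe ye; rewrite -/u -/v in P.
have D := mul_rest_dot_le (u + v) u v.
have Dw : enorm (u + v - pr (u + v)) <= enorm (x - pr x) + enorm (y - pr y).
  have -> : u + v - pr (u + v) = dil deg t (x - pr x) + dil deg (1 - t) (y - pr y).
    by rewrite !dilB truncD -!trunc_dil opprD addrACA.
  apply: (le_trans (enormD _ _)); apply: lerD.
    apply: (le_trans (enorm_dil_le1 (deg_gt0 G) _ t01)).
    by rewrite ler_piMl ?enorm_ge0.
  apply: (le_trans (enorm_dil_le1 (deg_gt0 G) _ _)).
    by apply/andP; split; lra.
  by rewrite ler_piMl ?enorm_ge0//; lra.
have {D} := le_trans D (ler_pM (enorm_ge0 _) (enorm_ge0 _) Dw P).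
have : enorm (mul_rest u v) ^+ 2 <= (K * eta * (t * (1 - t)) *
     (enorm (x - pr x) + enorm (y - pr y) + enorm (pr x - pr y))) ^+ 2.
  by rewrite ler_pXn2r ?nnegrE ?enorm_ge0// (le_trans _ P)// enorm_ge0.
move: (\sum_j _) (enorm (mul_rest u v)) P => dot e _.
have x2 : enorm x ^+ 2 <= eta ^+ 2 by rewrite ler_pXn2r ?nnegrE ?enorm_ge0// ltW.
have y2 : enorm y ^+ 2 <= eta ^+ 2 by rewrite ler_pXn2r ?nnegrE ?enorm_ge0// ltW.
have W2 : t * enorm x ^+ 2 + (1 - t) * enorm y ^+ 2 <= eta ^+ 2.
  have : t * enorm x ^+ 2 <= t * eta ^+ 2 by rewrite ler_wpM2l.
  have : (1 - t) * enorm y ^+ 2 <= (1 - t) * eta ^+ 2 by rewrite ler_wpM2l// subr_ge0.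
  lra.
move: W; rewrite /defect.
have a0 := enorm_ge0 (x - pr x); have b0 := enorm_ge0 (y - pr y).
have c0 := enorm_ge0 (pr x - pr y).
set a := enorm (x - pr x) in a0 *; set b := enorm (y - pr y) in b0 *.
set c := enorm (pr x - pr y) in c0 *.
set Q := c ^+ 2 + (a ^+ 2 + b ^+ 2).
have SQ : (a + b + c) ^+ 2 <= 3 * Q.
  rewrite /Q; have := sqr_ge0 (a - b); have := sqr_ge0 (b - c); have := sqr_ge0 (a - c).
  lra.
have Q0 : 0 <= Q by rewrite !addr_ge0 ?sqr_ge0.
have k0 : 0 <= K * eta by rewrite mulr_ge0 ?ltW.
have tt0 : 0 <= t * (1 - t) by rewrite mulr_ge0 ?subr_ge0.
have tt1 : t * (1 - t) <= 1 by nra.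
move=> W He Hd.
have eK := eta_K; set k := K * eta in k0 eK He Hd *; set T := t * (1 - t) in tt0 tt1 W He Hd *.
have Hd1 : dot <= T * (20^-1 * (3 * Q)).
  apply: (le_trans Hd).
  rewrite [leLHS](_ : _ = T * (k * ((a + b) * (a + b + c)))); last by ring.
  rewrite ler_wpM2l//; apply: ler_pM => //; first by rewrite mulr_ge0 ?addr_ge0.
  apply: le_trans SQ; rewrite expr2 ler_wpM2r ?addr_ge0// lerDl//.
have He1 : e ^+ 2 <= T * (20^-1 * (3 * Q)).
  apply: (le_trans He).
  rewrite [leLHS](_ : _ = T * (T * k * k * (a + b + c) ^+ 2)); last by ring.
  rewrite ler_wpM2l//; apply: ler_pM => //; [by rewrite mulr_ge0// mulr_ge0|exact: sqr_ge0|].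
  have kk : 0 <= k * k by rewrite mulr_ge0.
  have : T * k * k <= k * k by rewrite -[T * k * k]mulrA ler_piMl.
  nra.
have TQ : 0 <= T * Q by rewrite mulr_ge0.
lra.
Qed.

Hypothesis s_gt0 : (0 < s)%N.
Local Notation N := (NHS deg eta).
Local Notation unit_sphere x := (dil deg (N x)^-1 x).

(** With [t = N u / (N u + N v)], the product is the dilate by [N u + N v] of the product of
    [dil t x] and [dil (1 - t) y], where [x] and [y] are the normalised factors. *)
Lemma NHS_mul_excess u v : 0 < N u -> 0 < N v ->
  N (mul u v) <= N u + N v
    - N u * N v / (N u + N v) * defect (unit_sphere u) (unit_sphere v)
      / (4 * s%:R * eta ^+ 2).
Proof.
move=> u0 v0; set a := N u in u0 *; set b := N v in v0 *.
set x := dil deg a^-1 u; set y := dil deg b^-1 v.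
have dg := deg_gt0 G; have ds := deg_le_step G.
have xe : enorm x <= eta by exact: (le_NHS dg ds eta0 u0 (lexx _)).
have ye : enorm y <= eta by exact: (le_NHS dg ds eta0 v0 (lexx _)).
have xu : dil deg a x = u by rewrite dilK ?gt_eqF.
have yv : dil deg b y = v by rewrite dilK ?gt_eqF.
clearbody x y.
have ab0 : 0 < a + b by rewrite addr_gt0.
pose t := a / (a + b).
have t' : 1 - t = b / (a + b) by rewrite /t; field; rewrite gt_eqF.
have t01 : 0 <= t <= 1.
  by rewrite divr_ge0 ?(ltW u0) ?(ltW ab0)//= ler_pdivrMr// mul1r lerDl ltW.
have H := enorm_mul_convex t01 xe ye.
set z := mul _ _ in H.
have -> : mul u v = dil deg (a + b) z.
  rewrite /z cg_dil// !dil_dil t' /t !(mulrC (a + b)) !divfK ?gt_eqF//.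
  by rewrite xu yv.
have Q0 := defect_ge0 x y; set Q := defect x y in H Q0 *.
rewrite (NHS_dil dg ds)//.
have s0 : 0 < s%:R :> R by rewrite ltr0n.
(* Chosen so that [eta ^+ 2 * (1 - c)] is the convexity bound on [enorm z ^+ 2]; then [c <= 1]
   because a square is nonnegative. *)
pose c := t * (1 - t) * Q / (2 * eta ^+ 2).
have e20 : 0 < eta ^+ 2 by rewrite exprn_gt0.
have cE : eta ^+ 2 * (1 - c) = eta ^+ 2 - t * (1 - t) / 2 * Q.
  by rewrite /c; field; rewrite gt_eqF.
have c0 : 0 <= c.
  case/andP: t01 => t0 t1; apply: divr_ge0; last by rewrite mulr_ge0 ?(ltW e20).
  by rewrite mulr_ge0// mulr_ge0// subr_ge0.
have c1 : c <= 1.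
  rewrite -subr_ge0 -(pmulr_rge0 _ e20) cE; apply: le_trans H; exact: sqr_ge0.
have := @NHS_improve _ _ deg s eta dg ds s_gt0 eta0 z c.
rewrite c0 c1 cE H => /(_ isT isT) Hz.
rewrite -(ler_pM2l ab0) in Hz; apply: (le_trans Hz).
rewrite le_eqVlt; apply/orP; left; apply/eqP; rewrite /c t' /t.
by field; rewrite !gt_eqF.
Qed.

Lemma NHS_mul_le u v : N (mul u v) <= N u + N v.
Proof.
have dg := deg_gt0 G; have ds := deg_le_step G.
have := NHS_ge0 dg eta0 u; rewrite le_eqVlt => /orP[/eqP/esym u0|u0].
  by rewrite (NHS_eq0 dg ds eta0 u0) cg_mul0l lerDr (NHS_ge0 dg).
have := NHS_ge0 dg eta0 v; rewrite le_eqVlt => /orP[/eqP/esym v0|v0].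
  by rewrite (NHS_eq0 dg ds eta0 v0) cg_mul0r lerDl (NHS_ge0 dg).
apply: (le_trans (NHS_mul_excess u0 v0)); rewrite gerBl.
rewrite divr_ge0//; last by rewrite mulr_ge0 ?sqr_ge0.
by rewrite mulr_ge0 ?defect_ge0// divr_ge0 ?mulr_ge0 ?addr_ge0// ltW.
Qed.

End Convexity.

(** * Deviation from the chord *)

Section Deviation.
#[local] Set Implicit Arguments.
#[local] Unset Strict Implicit.
Context {R : realType} {s n : nat} (G : carnotGroup R s n).
Variables (r K eta : R).
Hypotheses (r0 : 0 < r) (K0 : 0 < K) (mulL : mul_lipschitz G r K).
Hypotheses (eta0 : 0 < eta) (eta_r : 4 * eta < r) (eta_K : K * eta <= 20^-1).
Implicit Types x y z u v w p g h : 'rV[R]_n.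
Local Notation deg := (cg_deg G).
Local Notation mul := (cg_mul G).
Local Notation pr := (trunc deg 1).
Local Notation N := (NHS deg eta).

Let lt_r u : enorm u <= 3 * eta -> enorm u < r.
Proof. by move=> ue; apply: (le_lt_trans ue); move: eta0 eta_r; lra. Qed.

(** Here [K * enorm u <= 3 / 20], so the nonlinear correction is no larger than [v - v'] itself. *)
Lemma mul_close_r u v v' : enorm u <= 3 * eta -> enorm v <= 3 * eta ->
  enorm v' <= 3 * eta -> enorm (mul u v - mul u v') <= 2 * enorm (v - v').
Proof.
move=> ue ve v'e; have := mul_diffr r0 mulL (lt_r ue) (lt_r ve) (lt_r v'e).
have := enormD (mul u v - mul u v' - (v - v')) (v - v'); rewrite subrK.
have d0 := enorm_ge0 (v - v').
have : K * enorm u * enorm (v - v') <= enorm (v - v').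
  rewrite ler_piMl//; have : K * enorm u <= K * (3 * eta) by rewrite ler_pM2l.
  by move: eta_K; lra.
lra.
Qed.

Lemma mul_close_l u u' v : enorm u <= 3 * eta -> enorm u' <= 3 * eta ->
  enorm v <= 3 * eta -> enorm (mul u v - mul u' v) <= 2 * enorm (u - u').
Proof.
move=> ue u'e ve; have -> : mul u v - mul u' v = mul (- v) (- u') - mul (- v) (- u).
  by rewrite -!cg_oppM opprK addrC.
have <- : enorm (- u' - - u) = enorm (u - u') by rewrite opprK addrC.
by apply: mul_close_r; rewrite enormN.
Qed.

Lemma enorm_opp_mul u v : enorm u <= 3 * eta -> enorm v <= 3 * eta ->
  enorm (mul (- u) v) <= 2 * enorm (u - v).
Proof.
move=> ue ve; have := mul_close_r (u := - u) (v := v) (v' := u).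
by rewrite enormN cg_mulNl subr0 enormB; apply.
Qed.

Variables (x y : 'rV[R]_n) (t q : R).
Hypotheses (xe : enorm x <= eta) (ye : enorm y <= eta) (t01 : 0 <= t <= 1).
Hypotheses (qX : enorm (pr x - pr y) <= q) (qx : enorm (x - pr x) <= q).

Let Xe : enorm (pr x) <= eta. Proof. exact: le_trans (enorm_trunc _ _ _) xe. Qed.
Let Ye : enorm (pr y) <= eta. Proof. exact: le_trans (enorm_trunc _ _ _) ye. Qed.

Let scale_le (a : R) z : 0 <= a <= 1 -> enorm (a *: z) <= enorm z.
Proof. by move=> /andP[a0 a1]; rewrite enormZ ger0_norm// ler_piMl ?enorm_ge0. Qed.

(** The horizontal projection of the product of [dil t x] and [dil (1 - t) y], the rescaled
    chord. *)
Let chord := t *: pr x + (1 - t) *: pr y.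

Let chord_le (a : R) : 0 <= a <= 1 -> enorm (a *: chord) <= 3 * eta.
Proof.
case/andP: t01 => t0 t1 a01; apply: (le_trans (scale_le _ a01)).
apply: (le_trans (enormD _ _)).
have : enorm (t *: pr x) <= enorm (pr x) by exact: scale_le.
have : enorm ((1 - t) *: pr y) <= enorm (pr y).
  by apply: scale_le; apply/andP; split; lra.
by move: Xe Ye eta0; lra.
Qed.

Let chord_dist (a : R) : 0 <= a <= 1 -> enorm (a *: pr x - a *: chord) <= q.
Proof.
case/andP: t01 => t0 t1 a01; rewrite -scalerBr.
have -> : pr x - chord = (1 - t) *: (pr x - pr y).
  by apply/rowP => j; rewrite !mxE; ring.
apply: (le_trans (scale_le _ a01)); apply: le_trans qX; apply: scale_le.
by apply/andP; split; lra.
Qed.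

Lemma first_leg_dev (tau : R) : 0 <= tau <= 1 -> exists2 tau' : R, 0 <= tau' <= 1 &
  enorm (mul (- (tau *: (t *: pr x))) (tau' *: chord)) <= 10 * q.
Proof.
move=> /andP[tau0 tau1]; have /andP[t0 t1] := t01.
have a01 : 0 <= tau * t <= 1 by rewrite mulr_ge0// mulr_ile1.
(* At this parameter the points [(tau t) pr x] and [(tau t) chord] are compared, which are
   [q]-close. *)
exists (tau * t) => //; rewrite scalerA.
have ue : enorm ((tau * t) *: pr x) <= 3 * eta.
  by apply: (le_trans (scale_le _ a01)); move: Xe eta0; lra.
apply: (le_trans (enorm_opp_mul ue (chord_le a01))).
have q0 : 0 <= q := le_trans (enorm_ge0 _) qX.
by have := chord_dist a01; lra.
Qed.

(** With [b = tau (1 - t)], replace [u] by [t pr x] (cost [2 q]), then [b pr y] by [b pr x] (cost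
    [2 q]); the result [(t + b) pr x] is [q]-close to [(t + b) chord]. [enorm_opp_mul] doubles the
    total [5 q]. *)
Lemma second_leg_dev (tau : R) : 0 <= tau <= 1 -> exists2 tau' : R, 0 <= tau' <= 1 &
  enorm (mul (- mul (dil deg t x) (tau *: ((1 - t) *: pr y))) (tau' *: chord)) <= 10 * q.
Proof.
move=> /andP[tau0 tau1]; have /andP[t0 t1] := t01.
have t'01 : 0 <= 1 - t <= 1 by apply/andP; split; lra.
have b01 : 0 <= tau * (1 - t) <= 1.
  by case/andP: t'01 => *; rewrite mulr_ge0// mulr_ile1.
have a01 : 0 <= t + tau * (1 - t) <= 1 by apply/andP; split; nra.
exists (t + tau * (1 - t)) => //; rewrite scalerA.
set b := tau * (1 - t) in b01 a01 *; set u := dil deg t x.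
have ue : enorm u <= eta.
  apply: (le_trans (enorm_dil_le1 (deg_gt0 G) _ t01)); apply: le_trans xe.
  by rewrite ler_piMl ?enorm_ge0.
have tXe : enorm (t *: pr x) <= eta by exact: le_trans (scale_le _ t01) Xe.
have bYe : enorm (b *: pr y) <= eta by exact: le_trans (scale_le _ b01) Ye.
have bXe : enorm (b *: pr x) <= eta by exact: le_trans (scale_le _ b01) Xe.
have e3 z : enorm z <= eta -> enorm z <= 3 * eta by move: eta0; lra.
have H1 := mul_close_l (e3 _ ue) (e3 _ tXe) (e3 _ bYe).
have H2 := mul_close_r (e3 _ tXe) (e3 _ bYe) (e3 _ bXe).
have H3 := chord_dist a01.
have uX : enorm (u - t *: pr x) <= q.
  rewrite -(dil_trunc1 (deg_gt0 G)) -dilB; apply: le_trans qx.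
  apply: (le_trans (enorm_dil_le1 (deg_gt0 G) _ t01)).
  by rewrite ler_piMl ?enorm_ge0.
have YX : enorm (b *: pr y - b *: pr x) <= q.
  by rewrite -scalerBr; apply: (le_trans (scale_le _ b01)); rewrite enormB.
(* Both factors have length at most [eta], and the correction to their sum is at most another
   [eta]. *)
have Ue : enorm (mul u (b *: pr y)) <= 3 * eta.
  have z0 : enorm (0 : 'rV[R]_n) <= 3 * eta by rewrite enorm0; move: eta0; lra.
  have := mul_close_r (e3 _ ue) (e3 _ bYe) z0; rewrite cg_mul0r subr0.
  have := mul_diffr r0 mulL (lt_r (e3 _ ue)) (lt_r (e3 _ bYe)) (lt_r z0).
  rewrite cg_mul0r subr0 => H _.
  have := enormD (mul u (b *: pr y) - u - b *: pr y) (u + b *: pr y).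
  have -> : mul u (b *: pr y) - u - b *: pr y + (u + b *: pr y) = mul u (b *: pr y).
    by rewrite addrA addrAC subrK subrK.
  have := enormD u (b *: pr y).
  have : K * enorm u * enorm (b *: pr y) <= eta.
    apply: le_trans bYe; rewrite ler_piMl ?enorm_ge0//.
    have : K * enorm u <= K * eta by rewrite ler_pM2l.
    by move: eta_K; lra.
  by move: H; lra.
apply: (le_trans (enorm_opp_mul Ue (chord_le a01))).
have E : mul (t *: pr x) (b *: pr x) = (t + b) *: pr x by rewrite cg_exp.
have T1 := enorm_dist (mul u (b *: pr y)) (mul (t *: pr x) (b *: pr y)) ((t + b) *: chord).
have T2 := enorm_dist (mul (t *: pr x) (b *: pr y)) (mul (t *: pr x) (b *: pr x))
  ((t + b) *: chord).
rewrite E in T2 H2.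
lra.
Qed.

End Deviation.

(** * Quotient distances, excesses and suprema of deviations *)

Section Distances.
#[local] Set Implicit Arguments.
#[local] Unset Strict Implicit.
Context {R : realType} {s n : nat} (G : carnotGroup R s n).
Variable eta : R.
Hypothesis eta0 : 0 < eta.
Hypothesis NHS_subadd : forall u v : 'rV[R]_n,
  NHS (cg_deg G) eta (cg_mul G u v) <= NHS (cg_deg G) eta u + NHS (cg_deg G) eta v.
Implicit Types x y z u v w p g h : 'rV[R]_n.
Local Notation deg := (cg_deg G).
Local Notation mul := (cg_mul G).
Local Notation pr := (trunc deg 1).
Local Notation N := (NHS deg eta).

Lemma dHSE g h : dHS G eta g h = N (mul (- g) h).
Proof. by rewrite /dHS cg_invE. Qed.

Lemma qdHS_cpi i g h : qdHS G eta i (cpi G i g) (cpi G i h) = N (trunc deg i (mul (- g) h)).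
Proof.
rewrite /qdHS /qmul /qinv /cpi cg_invE truncN truncK -truncN.
by rewrite -trunc_mul.
Qed.

Lemma qdHS_triangle i p g h : qdHS G eta i (cpi G i p) (cpi G i h)
  <= qdHS G eta i (cpi G i p) (cpi G i g) + qdHS G eta i (cpi G i g) (cpi G i h).
Proof.
rewrite !qdHS_cpi.
have -> : mul (- p) h = mul (mul (- p) g) (mul (- g) h) by rewrite -cg_mulA cg_mulKV.
rewrite trunc_mul; apply: le_trans (NHS_subadd _ _).
exact: (NHS_trunc (deg_gt0 G) (deg_le_step G) eta0).
Qed.

(** The triangle inequality through [p2] removes that point from the excess. *)
Lemma excess_ge i p1 p2 p3 p4 :
  qdHS G eta i (cpi G i p1) (cpi G i p3) + qdHS G eta i (cpi G i p3) (cpi G i p4)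
    - qdHS G eta i (cpi G i p1) (cpi G i p4) <= excess G eta i [:: p1; p2; p3; p4].
Proof.
rewrite /excess /= !big_ord_recl big_ord0 /= addr0.
by rewrite lerD2r addrA lerD2r; exact: qdHS_triangle.
Qed.

Lemma excess_ge0 i p1 p2 p3 p4 : 0 <= excess G eta i [:: p1; p2; p3; p4].
Proof.
apply: le_trans (excess_ge _ _ _ _ _).
by rewrite subr_ge0; exact: qdHS_triangle.
Qed.

Lemma hlineE g h (tau : R) : hline G g h tau = mul g (tau *: pr (mul (- g) h)).
Proof. by rewrite /hline cg_invE dil_trunc1//; exact: deg_gt0. Qed.

(** An infimum of nonnegative distances is at most any one of them, so one competitor [tau'] for
    each [tau] suffices. *)
Lemma sup_dev_le i (l B : R) g h p p' : 0 < l ->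
  (forall tau, 0 <= tau <= 1 -> exists2 tau', 0 <= tau' <= 1 &
     N (trunc deg i (mul (- hline G g h tau) (hline G p p' tau'))) ^+ (2 * i)
       <= B * l ^+ (2 * i - 1)) ->
  sup_dev G eta i l g h (hsegment G p p') <= B.
Proof.
move=> l0 H; have dg := deg_gt0 G; apply: ge_sup.
  by apply: image_nonempty; exists 0; rewrite /= in_itv/= lexx ler01.
move=> _ [tau /= tau01 <-]; rewrite in_itv/= in tau01.
have [tau' tau'01 Ht] := H _ tau01.
rewrite ler_pdivrMr ?exprn_gt0//; apply: le_trans Ht.
set A := cpi G i @` _.
have Ap : A (cpi G i (hline G p p' tau')).
  by exists (hline G p p' tau') => //; exists tau' => //=; rewrite in_itv.
have lb : lbound [set qdHS G eta i (cpi G i (hline G g h tau)) z | z in A] 0.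
  by move=> _ [z _ <-]; exact: (NHS_ge0 dg eta0).
have q0 : 0 <= qdist G eta i (cpi G i (hline G g h tau)) A.
  by apply: lb_le_inf => //; apply: image_nonempty; exists (cpi G i (hline G p p' tau')).
rewrite -qdHS_cpi lerXn2r ?nnegrE//; first exact: (NHS_ge0 dg eta0).
by apply: ge_inf; [exists 0|exists (cpi G i (hline G p p' tau'))].
Qed.

(** Homogeneity contributes [(2 l)^(2 i)]; since [10 q <= 40 eta], [NHS_expr_le] with [B = 40]
    contributes [40^(2 i) * 100 (q / eta)^2]. The powers combine to [6400^i], and one factor [l] is
    split off. *)
Lemma dil_dev_le i (l mu q : R) w : (0 < i <= s)%N -> 0 < mu -> mu <= 2 * l ->
  0 <= q -> q <= 4 * eta -> enorm w <= 10 * q ->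
  N (trunc deg i (dil deg mu w)) ^+ (2 * i)
    <= 6400 ^+ s * 100 * (l * (q / eta) ^+ 2) * l ^+ (2 * i - 1).
Proof.
move=> /andP[i0 i_s] mu0 mul2 q0 q4 wq.
have dg := deg_gt0 G; have ds := deg_le_step G.
have l0 : 0 < l by lra.
rewrite trunc_dil (NHS_dil dg ds eta0)// exprMn.
set w' := trunc deg i w.
have w'q : enorm w' <= 10 * q by exact: le_trans (enorm_trunc _ _ _) wq.
have w'e : enorm w' <= 40 * eta by lra.
have Nw := @NHS_expr_le _ _ deg s eta dg ds (leq_trans i0 i_s) eta0 i 40 w'.
have B40 : 1 <= 40 :> R by lra.
have {}Nw := Nw B40 (truncK _ _ _) w'e i0.
have N2 : N w' ^+ (2 * i) <= (40 ^+ i * (10 * (q / eta))) ^+ 2.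
  rewrite mulnC exprM ler_pXn2r ?nnegrE ?exprn_ge0 ?(NHS_ge0 dg)//; last first.
    by rewrite mulr_ge0 ?exprn_ge0// mulr_ge0// divr_ge0// ltW.
  by apply: (le_trans Nw); rewrite ler_wpM2l ?exprn_ge0// mulrA ler_wpM2r// invr_ge0 ltW.
have M2 : mu ^+ (2 * i) <= 4 ^+ i * l ^+ (2 * i).
  have -> : 4 ^+ i * l ^+ (2 * i) = (2 * l) ^+ (2 * i).
    by rewrite exprMn (exprM 2); congr (_ ^+ _ * _); ring.
  by rewrite lerXn2r ?nnegrE ?mulr_ge0 ?(ltW l0) ?(ltW mu0).
have NN : 0 <= N w' ^+ (2 * i) by rewrite exprn_ge0// (NHS_ge0 dg).
apply: (le_trans (ler_pM (exprn_ge0 _ (ltW mu0)) NN M2 N2)).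
have -> : 4 ^+ i * l ^+ (2 * i) * (40 ^+ i * (10 * (q / eta))) ^+ 2
    = 6400 ^+ i * (100 * (l * (q / eta) ^+ 2) * l ^+ (2 * i - 1)).
  have -> : (6400 : R) ^+ i = 4 ^+ i * (40 ^+ i) ^+ 2.
    by rewrite -exprM mulnC exprM -exprMn; congr (_ ^+ _); ring.
  have -> : l ^+ (2 * i) = l * l ^+ (2 * i - 1).
    by rewrite -exprS subn1 prednK// muln_gt0.
  ring.
rewrite -!mulrA ler_wpM2r//; last by rewrite ler_eXn2l//; lra.
by rewrite !mulr_ge0 ?sqr_ge0 ?exprn_ge0 ?invr_ge0 ?(ltW l0) ?(ltW eta0).
Qed.

End Distances.

(** * Choice of constants and assembly of the excess and deviation bounds *)

Theorem proposition5p6 (R : realType) (s n : nat) (G : carnotGroup R s n)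
    (hs : (2 <= s)%N) :
  exists eta0 : R, 0 < eta0 /\
  forall eta : R, 0 < eta -> eta <= eta0 ->
  forall lam : R, 0 < lam ->
  exists C : R, 0 < C /\
  forall (p1 p2 p3 p4 : 'rV[R]_n) (l : R), 0 < l ->
    (forall i j : 'I_4, i != j ->
       let p := [:: p1; p2; p3; p4] in
       lam * l <= dHS G eta (nth 0 p i) (nth 0 p j) /\
       dHS G eta (nth 0 p i) (nth 0 p j) <= l) ->
    \sum_(1 <= i < s.+1)
       (sup_dev G eta i l p1 p3 (hsegment G p1 p4)
        + sup_dev G eta i l p3 p4 (hsegment G p1 p4))
    <= C * \sum_(2 <= i < s.+1) excess G eta i [:: p1; p2; p3; p4].
Proof.
have [r [K [r0 K0 mulL]]] := mul_lipschitzP G.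
have dg := deg_gt0 G; have ds := deg_le_step G.
have s0 : (0 < s)%N by exact: leq_trans hs.
(* The first bound gives [4 * eta < r] strictly, the second [K * eta <= 1 / 20]. *)
exists (Num.min (r / 5) ((20 * K)^-1)).
split; first by rewrite lt_min divr_gt0 ?invr_gt0 ?mulr_gt0.
move=> eta eta0; rewrite le_min => /andP[eta_r5 eta_K20].
have eta_K : K * eta <= 20^-1.
  by rewrite -ler_pdivlMl// -invfM mulrC.
have eta_r1 : eta < r by lra.
have eta_r4 : 4 * eta < r by lra.
have subadd := NHS_mul_le r0 K0 mulL eta0 eta_r1 eta_K s0.
move=> lam lam0.
have s0R : 0 < s%:R :> R by rewrite ltr0n.
have [c c0 cE] : exists2 c : R, 0 < c & c = 6400 ^+ s * 100.
  by eexists; last reflexivity; apply: mulr_gt0; rewrite ?exprn_gt0 ?ltr0n.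
(* [c] comes from [dil_dev_le]; the other factor inverts the product of [lam^2 / 2], from the
   separation of the points, and [1 / (4 s)], from [NHS_mul_excess]. *)
have [B B0 BE] : exists2 B, 0 < B & B = c * (8 * s%:R / lam ^+ 2).
  by eexists; last reflexivity; rewrite mulr_gt0// divr_gt0 ?mulr_gt0 ?exprn_gt0.
(* Two suprema for each of [s] indices, each at most [B * D]. *)
exists (2 * s%:R * B); split; first by rewrite !mulr_gt0.
move=> p1 p2 p3 p4 l l0 Hp.
set D := \sum_(2 <= i < s.+1) _.
(* Indices start at 0: these are the pairs (p1, p3) and (p3, p4). *)
have /= [a_ge a_le] := Hp (inord 0) (inord 2) ltac:(by rewrite -val_eqE /= !inordK).
have /= [b_ge b_le] := Hp (inord 2) (inord 3) ltac:(by rewrite -val_eqE /= !inordK).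
rewrite !inordK//= !dHSE in a_ge a_le b_ge b_le.
set a := cg_mul G (- p1) p3 in a_ge a_le.
set b := cg_mul G (- p3) p4 in b_ge b_le.
have ab : cg_mul G a b = cg_mul G (- p1) p4.
  by rewrite /a /b -cg_mulA cg_mulKV.
have ll0 : 0 < lam * l by rewrite mulr_gt0.
have Na0 := lt_le_trans ll0 a_ge; have Nb0 := lt_le_trans ll0 b_ge.
have := NHS_mul_excess r0 K0 mulL eta0 eta_r1 eta_K s0 Na0 Nb0.
set al := NHS _ _ a in a_ge a_le Na0 *; set be := NHS _ _ b in b_ge b_le Nb0 *.
have xe : enorm (dil (cg_deg G) al^-1 a) <= eta.
  exact: (le_NHS dg ds eta0 Na0 (lexx _)).
have ye : enorm (dil (cg_deg G) be^-1 b) <= eta.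
  exact: (le_NHS dg ds eta0 Nb0 (lexx _)).
have xa := dilK (cg_deg G) a (lt0r_neq0 Na0); have yb := dilK (cg_deg G) b (lt0r_neq0 Nb0).
move: xe ye xa yb.
set x := dil _ al^-1 a; set y := dil _ be^-1 b => xe ye xa yb Hexc.
pose mu := al + be; pose t := al / mu.
have mu0 : 0 < mu by rewrite addr_gt0.
have mu2 : mu <= 2 * l by rewrite /mu; lra.
have t' : 1 - t = be / mu by rewrite /t /mu; field; rewrite gt_eqF.
have t01 : 0 <= t <= 1.
  by rewrite divr_ge0 ?(ltW Na0) ?(ltW mu0)//= ler_pdivrMr// mul1r lerDl ltW.
pose q := Num.sqrt (defect G x y).
have Q0 := defect_ge0 G x y.
have q0 : 0 <= q by exact: sqrtr_ge0.
have q2 : q ^+ 2 = defect G x y by rewrite sqr_sqrtr.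
have le_q z : 0 <= z -> z ^+ 2 <= defect G x y -> z <= q.
  by move=> z0 zQ; rewrite -(ler_pXn2r (n := 2)) ?nnegrE// q2.
have qX : enorm (trunc (cg_deg G) 1 x - trunc (cg_deg G) 1 y) <= q.
  by apply: le_q; rewrite ?enorm_ge0// lerDl addr_ge0 ?sqr_ge0.
have qx : enorm (x - trunc (cg_deg G) 1 x) <= q.
  apply: le_q; rewrite ?enorm_ge0// /defect.
  by rewrite addrCA lerDl addr_ge0 ?sqr_ge0.
(* Each of the three squares in the defect is at most [4 eta^2], and 12 is below 16. *)
have q4 : q <= 4 * eta.
  rewrite -(ler_pXn2r (n := 2)) ?nnegrE//; last by rewrite mulr_ge0 ?(ltW eta0).
  have sq (z w : 'rV[R]_n) : enorm z <= eta -> enorm w <= eta ->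
      enorm (z - w) ^+ 2 <= 4 * eta ^+ 2.
    move=> ze we; have : enorm (z - w) <= 2 * eta.
      by apply: (le_trans (enormD _ _)); rewrite enormN; lra.
    have := enorm_ge0 (z - w); move: eta0; nra.
  have Xe := le_trans (enorm_trunc (cg_deg G) 1 x) xe.
  have Ye := le_trans (enorm_trunc (cg_deg G) 1 y) ye.
  have := sq _ _ Xe Ye; have := sq _ _ xe Xe; have := sq _ _ ye Ye.
  rewrite q2 /defect; have := sqr_ge0 eta.
  move: (enorm (x - _)) (enorm (y - _)) (enorm (trunc _ _ _ - _)) => c1 c2 c3.
  lra.
(* The last summand of [D] has index [s], where truncation is the identity; the others are
   nonnegative. *)
have excD : al + be - NHS (cg_deg G) eta (cg_mul G a b) <= D.
  rewrite /D big_nat_recr //= ab; apply: le_trans (ler_wpDl _ (lexx _)); last first.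
    by apply: sumr_ge0 => i _; exact: excess_ge0.
  apply: le_trans (excess_ge eta0 subadd s p1 p2 p3 p4).
  by rewrite !qdHS_cpi !trunc_step.
have lq : l * (q / eta) ^+ 2 <= 8 * s%:R / lam ^+ 2 * D.
  have e20 : 0 < eta ^+ 2 by rewrite exprn_gt0.
  have lam20 : 0 < lam ^+ 2 by rewrite exprn_gt0.
  have ratio : lam ^+ 2 * l / 2 <= al * be / mu.
    rewrite ler_pdivlMr// /mu.
    have : (lam * l) * (lam * l) <= al * be by apply: ler_pM => //; exact: ltW.
    have : lam ^+ 2 * l / 2 * (al + be) <= lam ^+ 2 * l / 2 * (2 * l).
      by rewrite ler_pM2l// divr_gt0// mulr_gt0.
    lra.
  have Qs0 : 0 <= defect G x y / (4 * s%:R * eta ^+ 2).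
    by rewrite divr_ge0// ltW// mulr_gt0// mulr_gt0.
  have H1 : lam ^+ 2 * l / 2 * (defect G x y / (4 * s%:R * eta ^+ 2))
      <= al * be / mu * defect G x y / (4 * s%:R * eta ^+ 2).
    by rewrite -[leRHS]mulrA; exact: ler_wpM2r.
  have H2 : lam ^+ 2 * l / 2 * (defect G x y / (4 * s%:R * eta ^+ 2)) <= D.
    by apply: (le_trans H1); apply: le_trans excD; rewrite lerBrDr -lerBrDl.
  rewrite expr_div_n q2.
  have -> : l * (defect G x y / eta ^+ 2) = 8 * s%:R / lam ^+ 2 *
      (lam ^+ 2 * l / 2 * (defect G x y / (4 * s%:R * eta ^+ 2))).
    by field; rewrite !gt_eqF.
  by rewrite ler_wpM2l// divr_ge0 ?mulr_ge0 ?(ltW lam20)// ltW.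
have D0 : 0 <= D by apply: sumr_ge0 => i _; exact: excess_ge0.
(* What remains for each leg is to exhibit the displacement to the chord as a [mu]-dilate of a
   vector of length at most [10 q]. *)
have key i g h : (1 <= i < s.+1)%N ->
  (forall tau, 0 <= tau <= 1 -> exists2 tau', 0 <= tau' <= 1 &
    exists2 w, enorm w <= 10 * q &
      cg_mul G (- hline G g h tau) (hline G p1 p4 tau') = dil (cg_deg G) mu w) ->
  sup_dev G eta i l g h (hsegment G p1 p4) <= B * D.
  move=> /andP[i1 i_s] H; apply: sup_dev_le => // tau /H[tau' tau'01 [w wq E]].
  exists tau' => //; rewrite E.
  have i01 : (0 < i <= s)%N by rewrite i1.
  apply: (le_trans (dil_dev_le G eta0 i01 mu0 mu2 q0 q4 wq)).
  rewrite -cE ler_wpM2r ?exprn_ge0 ?(ltW l0)// BE -[leRHS]mulrA ler_wpM2l//.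
  exact: ltW.
have legs i : (1 <= i < s.+1)%N ->
  sup_dev G eta i l p1 p3 (hsegment G p1 p4)
    + sup_dev G eta i l p3 p4 (hsegment G p1 p4) <= 2 * (B * D).
  move=> i1s; rewrite mulr_natl mulr2n.
  have horiz k (z : 'rV[R]_n) : dil (cg_deg G) mu (k *: trunc (cg_deg G) 1 z)
      = (mu * k) *: trunc (cg_deg G) 1 z by rewrite -!dil_trunc1// dil_dil.
  have prx : trunc (cg_deg G) 1 a = al *: trunc (cg_deg G) 1 x.
    by rewrite -xa trunc_dil dil_trunc1.
  have pry : trunc (cg_deg G) 1 b = be *: trunc (cg_deg G) 1 y.
    by rewrite -yb trunc_dil dil_trunc1.
  have mut : mu * t = al by rewrite /t mulrC divfK ?gt_eqF.
  have mut' : mu * (1 - t) = be by rewrite t' mulrC divfK ?gt_eqF.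
  (* Horizontal parts add under the product, and [mu t = al], [mu (1 - t) = be], so the segment from
     [p1] to [p4] is a translated dilate of the normalised chord. *)
  have base tau' : hline G p1 p4 tau' = cg_mul G p1 (dil (cg_deg G) mu
      (tau' *: (t *: trunc (cg_deg G) 1 x + (1 - t) *: trunc (cg_deg G) 1 y))).
    rewrite hlineE -ab trunc1_mul prx pry; congr cg_mul.
    rewrite !scalerDr dilD !scalerA !horiz !mulrA ![mu * tau']mulrC -!mulrA.
    by rewrite mut mut'.
  (* Left translation cancels and dilations are automorphisms, which reduces both legs to the
     normalised picture based at 0. *)
  have leg (p U V : 'rV[R]_n) :
      cg_mul G (- cg_mul G p (dil (cg_deg G) mu U)) (cg_mul G p (dil (cg_deg G) mu V))
      = dil (cg_deg G) mu (cg_mul G (- U) V).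
    by rewrite cg_oppM -cg_mulA cg_mulVK -dilN cg_dil.
  apply: lerD; apply: key => // tau tau01.
    have [tau' tau'01 H] := first_leg_dev r0 K0 mulL eta0 eta_r4 eta_K xe ye t01 qX tau01.
    exists tau' => //; eexists; first exact: H.
    by rewrite base -(leg p1) hlineE -/a prx !scalerA horiz mulrCA mulrA -mulrA mut.
  have [tau' tau'01 H] := second_leg_dev r0 K0 mulL eta0 eta_r4 eta_K xe ye t01 qX qx tau01.
  exists tau' => //; eexists; first exact: H.
  rewrite base -(leg p1) hlineE -/b pry cg_dil// dil_dil mut xa /a -cg_mulA cg_mulKV.
  by rewrite !scalerA horiz mulrCA mut'.
rewrite big_nat; apply: le_trans (ler_sum _ legs) _.
rewrite -big_nat sumr_const_nat subn1 /= -mulr_natr.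
by rewrite le_eqVlt; apply/orP; left; apply/eqP; ring.
Qed.
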